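(* Let $a,b\ge0$ be integers with $a+b\ge1$, and $R>0$. Then for every $\phi\in C_{(a,b),R}$ the function $\mathcal{S}^{a,b}(\phi)$ belongs to $D^{a+b}_R$, and the map $\mathcal{S}^{a,b}:C_{(a,b),R}\to D^{a+b}_R$ is continuous (with respect to the maximum norm on $C_{(a,b),R}$ and $\|\cdot\|_{D^{a+b}}$).
   Context: $C_b((0,\infty))$: continuous functions on $(0,\infty)$ with support bounded above. For $c>0$, $D^{c}_R$ is the set of $\zeta\in C_b((0,\infty))$ with support in $(0,R]$, $\lim_{t\to0}t^c\zeta(t)=0$ and $\lim_{t\to0}\int_t^\infty\zeta(r)r^{c-1}dr$ existing and finite, normed by $\|\zeta\|_{D^c}=\sup_{t>0}t^c|\zeta(t)|+\sup_{t>0}|\int_t^\infty\zeta(r)r^{c-1}dr|$. For $\phi\in C_c([0,\infty)^2)$ and $s,t>0$ define $\tilde{\mathcal{S}}^{a,b}(\phi)[s,t]=\frac{1}{s^{a-1}t^{b-1}}\frac{\partial}{\partial s}\frac{\partial}{\partial t}\Big(s^at^b\int_t^\infty\int_s^\infty\frac{\phi(u,v)}{u^{a+1}v^{b+1}}du\,dv\Big)$, and $\mathcal{S}^{a,b}(\phi)(t)=\tilde{\mathcal{S}}^{a,b}(\phi)[t/\sqrt2,t/\sqrt2]$ for $t>0$. $C_{(a,b),R}$ is the space of $\phi\in C_c([0,\infty)^2)$ supported in $B_R(0)$ such that $\tilde{\mathcal{S}}^{a,b}(\phi)[s,t]$ depends only on $s^2+t^2$ for $s,t>0$, equipped with the maximum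 norm. *)

(* Defs.v *)
From HB Require Import structures.
From mathcomp Require Import all_boot all_order all_algebra.
From mathcomp Require Import all_classical all_reals all_analysis.
Set Implicit Arguments. Unset Strict Implicit. Unset Printing Implicit Defensive.
Import Order.TTheory GRing.Theory Num.Theory.
Import numFieldNormedType.Exports.
Local Open Scope classical_set_scope.
Local Open Scope ring_scope.

Section Defs.
Variable R : realType.

Notation leb := (@lebesgue_measure R).

Definition quadrant : set (R * R) := [set x | 0 <= x.1 /\ 0 <= x.2].

Definition in_Cc_ball (Rad : R) (phi : R * R -> R) : Prop :=
  {within quadrant, continuous phi} /\
  closure [set x | quadrant x /\ phi x != 0] `<=` [set x | x.1 ^+ 2 + x.2 ^+ 2 < Rad ^+ 2].

Definition max_norm (phi : R * R -> R) : R := sup [set `|phi x| | x in quadrant].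

Definition Stilde (a b : nat) (phi : R * R -> R) (s t : R) : R :=
  let H := fun s' t' : R => s' ^+ a * t' ^+ b *
     Rintegral leb `[t', +oo[%classic (fun v =>
       Rintegral leb `[s', +oo[%classic (fun u =>
         phi (u, v) / (u ^+ a.+1 * v ^+ b.+1))) in
  (s ^ (a%:Z - 1) * t ^ (b%:Z - 1))^-1 *
    derive1 (fun s' => derive1 (fun t' => H s' t') t) s.

Definition Sab (a b : nat) (phi : R * R -> R) (t : R) : R :=
  Stilde a b phi (t / Num.sqrt 2) (t / Num.sqrt 2).

Definition in_Cab (a b : nat) (Rad : R) (phi : R * R -> R) : Prop :=
  in_Cc_ball Rad phi /\
  forall s t s' t' : R, 0 < s -> 0 < t -> 0 < s' -> 0 < t' ->
    s ^+ 2 + t ^+ 2 = s' ^+ 2 + t' ^+ 2 -> Stilde a b phi s t = Stilde a b phi s' t'.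

Definition tailD (c : nat) (zeta : R -> R) (t : R) : R :=
  Rintegral leb `[t, +oo[%classic (fun r => zeta r * r ^ (c%:Z - 1)).

Definition in_D (c : nat) (Rad : R) (zeta : R -> R) : Prop :=
  (forall t : R, 0 < t -> {for t, continuous zeta}) /\
  (forall t : R, Rad < t -> zeta t = 0) /\
  (t ^+ c * zeta t @[t --> 0^'+] --> 0) /\
  cvg (tailD c zeta t @[t --> 0^'+]).

Definition D_norm (c : nat) (zeta : R -> R) : R :=
  sup [set t ^+ c * `|zeta t| | t in [set t : R | 0 < t]] +
  sup [set `|tailD c zeta t| | t in [set t : R | 0 < t]].

End Defs.

(* Main.v *)
(* With H(s,t) = s^a t^b \int_t^oo \int_s^oo phi(u,v) u^(-a-1) v^(-b-1) du dv one has
   S~ = s^(-a) t^(-b) (s t d_s d_t H), and s t d_s d_t H is a combination of phi and of averages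
   of phi of the form n t^n \int_t^oo f(v) v^(-n-1) dv.  Such an average is bounded by sup |f| and
   tends to f(0) at 0, so s^a t^b S~ is bounded by 4 max |phi| and, since a + b >= 1, tends to
   phi(0) (1 - 1)(1 - 1) or phi(0) (1 - 1) = 0 on the diagonal.

   Let Z(r) = \int_r^oo zeta(x) x^(a+b-1) dx, where S~(s,t) = zeta(sqrt(s^2+t^2)).  If a = 0, then
   letting s tend to 0 gives Z(t) = t^b \int_t^oo phi(0,v) v^(-b-1) dv, and b = 0 is symmetric.
   If a, b >= 1, integrate s^(a-1) t^(b-1) S~ = d_s d_t H over the complement of the square
   [0,r]^2.  Evaluating at the corners gives the convergent quantity H(r,0) + H(0,r) - H(r,r);
   along the rays t = y s and s = y t, 0 <= y <= 1, it is a weighted mean of the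
   Z(r sqrt(1+y^2)).  The latter differ from Z(r) by at most sup_{r <= x <= 2r} x^(a+b) |zeta(x)|,
   which tends to 0 with r, so Z is bounded and converges.  The equality of the two expressions is
   obtained by comparing derivatives in r. *)

Require Import Defs.
From HB Require Import structures.
From mathcomp Require Import all_boot all_order all_algebra.
From mathcomp Require Import all_classical all_reals all_analysis.
From mathcomp Require Import ring lra.
Set Implicit Arguments.
Unset Strict Implicit.
Unset Printing Implicit Defensive.
Import Order.TTheory GRing.Theory Num.Theory.
Import numFieldNormedType.Exports.
Local Open Scope ring_scope.
Local Open Scope classical_set_scope.

(** * Integrals over half-lines *)

Section Tail.
Variable R : realType.
Notation leb := (@lebesgue_measure R).
Implicit Types (f g F : R -> R) (t x l : R) (n : nat).

Lemma is_derive1_continuous f x l : is_derive x 1 f l -> {for x, continuous f}.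
Proof. by case=> + _ => /derivable1_diffP/differentiable_continuous. Qed.

Lemma le_of_derive_le0 f df t x : t <= x ->
  (forall v, t <= v <= x -> is_derive v 1 f (df v)) ->
  (forall v, t <= v <= x -> df v <= 0) -> f x <= f t.
Proof.
move=> tx fdf df0.
have sub v : v \in `[t, x]%R -> t <= v <= x by rewrite in_itv.
have [||c /sub ctx e] := @MVT_segment R f df t x tx.
- by move=> v /subset_itv_oo_cc/sub/fdf.
- by apply: derivable_within_continuous => v /sub/fdf[].
- by rewrite -subr_le0 e mulr_le0_ge0 ?subr_ge0 ?df0.
Qed.

(** Both [F + f] and [F - f] have nonpositive derivative, hence are nonincreasing. This replaces
    bounding an integral by the integral of a dominating function. *)
Lemma norm_increment_le f df F dF t x : t <= x ->
  (forall v, t <= v <= x -> is_derive v 1 f (df v)) ->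
  (forall v, t <= v <= x -> is_derive v 1 F (- dF v)) ->
  (forall v, t <= v <= x -> `|df v| <= dF v) -> `|f t - f x| <= F t - F x.
Proof.
move=> tx fdf FdF le.
rewrite ler_norml; apply/andP; split.
- have : (F \+ f) x <= (F \+ f) t.
    apply: (@le_of_derive_le0 _ (fun v => - dF v + df v)) => // v vtx.
      by apply: is_deriveD; [exact: FdF|exact: fdf].
    by have := le _ vtx; rewrite ler_norml => /andP[? ?]; lra.
  by rewrite /= => ?; lra.
- have : (F \- f) x <= (F \- f) t.
    apply: (@le_of_derive_le0 _ (fun v => - dF v - df v)) => // v vtx.
      by apply: is_deriveB; [exact: FdF|exact: fdf].
    by have := le _ vtx; rewrite ler_norml => /andP[? ?]; lra.
  by rewrite /= => ?; lra.
Qed.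

Lemma derive0_const f : (forall x, 0 < x -> is_derive x 1 f 0) ->
  forall t x, 0 < t -> 0 < x -> f t = f x.
Proof.
move=> f0.
suff H t x : 0 < t -> t <= x -> f t = f x.
  by move=> t x t0 x0; case: (lerP t x) => [/H->//|/ltW/H->].
move=> t0 tx; have lt v : t <= v <= x -> 0 < v by case/andP => /(lt_le_trans t0).
apply/eqP; rewrite -subr_eq0 -normr_le0 -[leRHS](subrr (cst 0 t : R)).
apply: (@norm_increment_le f (cst 0) (cst 0) (cst 0)) => // v /lt v0.
- exact: f0.
- by rewrite oppr0; apply: is_derive_cst.
- by rewrite normr0.
Qed.

Definition tail f t := Rintegral leb `[t, +oo[ f.

(** Nothing is asked at [0], so division by powers of the variable stays inside the class
    ([tailfun_weight]). The explicit [L] lets families of functions share one truncation point. *)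
Definition tailfun L f :=
  (forall x, 0 < x -> {for x, continuous f}) /\ (forall x, L <= x -> f x = 0).

Lemma eq_tail f g t : (forall x, t <= x -> f x = g x) -> tail f t = tail g t.
Proof.
move=> fg; apply: eq_Rintegral => x; rewrite inE/= in_itv/= andbT; exact: fg.
Qed.

Lemma tail_eq0 f t : (forall x, t <= x -> f x = 0) -> tail f t = 0.
Proof.
move=> f0; rewrite (@eq_tail _ (cst 0)) ?/tail//.
by rewrite /Rintegral integral0.
Qed.

Lemma within_continuous_itv f t x : (forall v, t <= v <= x -> {for v, continuous f}) ->
  {within `[t, x], continuous f}.
Proof.
move=> cf; apply: continuous_in_subspaceT => v; rewrite inE/= in_itv/=; exact: cf.
Qed.

Lemma itv_integrable f t x : {within `[t, x], continuous f} ->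
  leb.-integrable `[t, x] (EFin \o f).
Proof. by move=> cf; apply: continuous_compact_integrable => //; exact: segment_compact. Qed.

Lemma tailfun_within L f t x : 0 < t -> tailfun L f -> {within `[t, x], continuous f}.
Proof.
move=> t0 [cf _]; apply: within_continuous_itv => v /andP[tv _].
by apply: cf; apply: lt_le_trans tv.
Qed.

Lemma tail_integrable L f t : 0 < t -> tailfun L f ->
  leb.-integrable `[t, +oo[ (EFin \o f).
Proof.
move=> t0 Tf; have [cf f0] := Tf.
have := itv_integrable (@tailfun_within L f t (Num.max t L) t0 Tf).
rewrite integrable_mkcond// => H; rewrite integrable_mkcond//.
suff -> : (EFin \o f) \_ `[t, +oo[ = (EFin \o f) \_ `[t, Num.max t L] by [].
apply/funext => v; rewrite !patchE !mem_setE !in_itv/= andbT.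
case: (lerP t v) => //= tv; case: (lerP v) => //= /ltW.
by rewrite ge_max => /andP[_ /f0 ->].
Qed.

Lemma tail_split L f t x : 0 < t -> t <= x -> tailfun L f ->
  tail f t = Rintegral leb `[t, x] f + tail f x.
Proof.
move=> t0 tx Tf; have := @Rintegral_itvB R f (BLeft t) +oo%O x.
move=> /(_ (tail_integrable t0 Tf)).
rewrite Rintegral_itv_obnd_cbnd; last first.
  apply: integrableS (tail_integrable (lt_le_trans t0 tx) Tf) => //.
  by apply: subset_itvr; rewrite bnd_simp.
by rewrite /tail => <- //; rewrite addrC subrK.
Qed.

Lemma tail_itv L f t x : 0 < t -> t <= x -> L <= x -> tailfun L f ->
  tail f t = Rintegral leb `[t, x] f.
Proof.
move=> t0 tx Lx Tf; rewrite (tail_split t0 tx Tf) tail_eq0 ?addr0// => v xv.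
by case: Tf => _ -> //; exact: le_trans xv.
Qed.

Lemma is_derive_tail L f t : 0 < t -> tailfun L f -> is_derive t 1 (tail f) (- f t).
Proof.
move=> t0 Tf.
(* Starting at [t / 2] puts [t] inside an interval on which [f] is continuous; near [t] the tail is
   the constant [tail f (t / 2)] minus the integral from [t / 2]. *)
have h0 : 0 < t / 2 by lra.
have [d1 d2] : derivable (fun y => Rintegral leb `[t / 2, y] f) t 1 /\
  (fun y => Rintegral leb `[t / 2, y] f)^`() t = f t.
  apply: (@continuous_FTC1_closed R f (t / 2) t (t + 1)); first lra.
  - by apply/itv_integrable/(tailfun_within h0 Tf).
  - lra.
  - exact: Tf.1.
have H : is_derive t 1 (fun y => Rintegral leb `[t / 2, y] f) (f t).
  by apply: DeriveDef; [exact: d1 | rewrite -derive1E].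
have := is_deriveB (is_derive_cst (tail f (t / 2)) t 1) H.
rewrite sub0r; apply: near_eq_is_derive; near=> y => /=.
rewrite (@tail_split L f (t / 2) y) //.
  by rewrite !fctE addrC addKr.
by apply/ltW; near: y; apply: lt_nbhsr; lra.
Unshelve. all: by end_near. Qed.

(** The difference has zero derivative on the positive axis and vanishes beyond [L]. Later
    identities between tails rest on this principle instead of on manipulations of integrals. *)
Lemma tail_unique L f F : tailfun L f ->
  (forall x, 0 < x -> is_derive x 1 F (- f x)) -> (forall x, L <= x -> F x = 0) ->
  forall t, 0 < t -> tail f t = F t.
Proof.
move=> Tf dF F0 t t0; apply/eqP; rewrite -subr_eq0; apply/eqP.
have m0 : 0 < Num.max t L by rewrite lt_max t0.
have -> : tail f t - F t = tail f (Num.max t L) - F (Num.max t L).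
  apply: (@derive0_const (tail f \- F)) => // x x0.
  have := is_deriveB (is_derive_tail x0 Tf) (dF x x0).
  by rewrite subrr.
rewrite F0 ?le_max ?lexx ?orbT// subr0 tail_eq0// => x.
by rewrite ge_max => /andP[_]; exact: Tf.2.
Qed.

End Tail.

(** * Weighted tails as averages, and their Euler equation *)

Section WeightedTail.
Variable R : realType.
Notation leb := (@lebesgue_measure R).
Implicit Types (f g F : R -> R) (t x l L M : R) (n : nat).

(** For [n > 0], [n * wtail n f t] is the mean of [f] for the probability density [n t^n v^(-n-1)]
    on [[t, oo)]. *)
Definition wtail n f t := t ^+ n * tail (fun v => f v / v ^+ n.+1) t.

Lemma is_derive1D f g x df dg d : is_derive x 1 f df -> is_derive x 1 g dg ->
  df + dg = d -> is_derive x 1 (fun v => f v + g v) d.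
Proof. by move=> Df Dg <-; exact: is_deriveD. Qed.

Lemma is_derive1B f g x df dg d : is_derive x 1 f df -> is_derive x 1 g dg ->
  df - dg = d -> is_derive x 1 (fun v => f v - g v) d.
Proof. by move=> Df Dg <-; exact: is_deriveB. Qed.

Lemma is_derive1Z c f x df d : is_derive x 1 f df ->
  c * df = d -> is_derive x 1 (fun v => c * f v) d.
Proof. by move=> Df <-; exact: is_deriveZ. Qed.

Lemma is_derive1M f g x df dg d : is_derive x 1 f df -> is_derive x 1 g dg ->
  df * g x + f x * dg = d -> is_derive x 1 (fun v => f v * g v) d.
Proof.
move=> Df Dg <-; apply: (is_derive_eq (is_deriveM Df Dg)).
by rewrite /GRing.scale/= addrC (mulrC df).
Qed.

Lemma is_derive_expn n x : is_derive x (1 : R) (fun v => v ^+ n) (n%:R * x ^+ n.-1).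
Proof.
have := @is_deriveX R R id n x 1 1 (is_derive_id x 1).
by rewrite exprfctE /GRing.scale/= mulr1.
Qed.

Lemma is_derive_expnV n x : 0 < x ->
  is_derive x (1 : R) (fun v => (v ^+ n)^-1) (- (n%:R / x ^+ n.+1)).
Proof.
move=> x0; have xn : x ^+ n != 0 by rewrite expf_neq0// gt_eqF.
have := @is_deriveV R (fun v => v ^+ n) x _ 1 xn (is_derive_expn n x).
move/is_derive_eq; apply; rewrite /GRing.scale/= mulNr; congr (- _); rewrite mulrC.
case: n xn => [|n] xn; first by rewrite !mul0r.
rewrite /= -mulrA; congr (_ * _).
by have := x0; rewrite !exprS => {}x0; field; rewrite expf_neq0 gt_eqF.
Qed.

Lemma tailfun_weight L n f : tailfun L f -> tailfun L (fun v => f v / v ^+ n).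
Proof.
case=> cf f0; split=> [x x0|x Lx]; last by rewrite f0 ?mul0r.
apply: continuousM; first exact: cf.
exact: is_derive1_continuous (is_derive_expnV n x0).
Qed.

Lemma eq_wtail n f g t : (forall x, t <= x -> f x = g x) -> wtail n f t = wtail n g t.
Proof. by move=> fg; congr (_ * _); apply: eq_tail => x tx; rewrite fg. Qed.

Lemma wtail_eq0 n f t : (forall x, t <= x -> f x = 0) -> wtail n f t = 0.
Proof. by move=> f0; rewrite /wtail tail_eq0 ?mulr0// => x tx; rewrite f0 ?mul0r. Qed.

(** The Euler equation [t w' = n w - f]: the power in front contributes [n w], the lower end of the
    integral contributes [- f]. *)
Lemma is_derive_wtail L n f t : 0 < t -> tailfun L f ->
  is_derive t 1 (wtail n f) ((n%:R * wtail n f t - f t) / t).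
Proof.
move=> t0 Tf.
apply: is_derive1M (is_derive_expn n t) (is_derive_tail t0 (tailfun_weight n.+1 Tf)) _.
rewrite /wtail.
have tn : t != 0 by rewrite gt_eqF.
case: n => [|n]; rewrite ?expr0 /= ?exprS; field => //.
by rewrite tn expf_neq0.
Qed.

(** Dividing by [t^n] turns the Euler equation into the hypothesis of [tail_unique]. *)
Lemma wtail_unique L n f F : tailfun L f ->
  (forall x, 0 < x -> is_derive x 1 F ((n%:R * F x - f x) / x)) ->
  (forall x, L <= x -> F x = 0) ->
  forall t, 0 < t -> wtail n f t = F t.
Proof.
move=> Tf dF F0 t t0.
have tn : t ^+ n != 0 by rewrite expf_neq0// gt_eqF.
rewrite /wtail; suff -> : tail (fun v => f v / v ^+ n.+1) t = F t * (t ^+ n)^-1.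
  by rewrite mulrC -mulrA mulVf// mulr1.
apply: (@tail_unique _ L _ (fun v => F v * (v ^+ n)^-1)) => //.
- exact: tailfun_weight.
- move=> x x0; have xn : x != 0 by rewrite gt_eqF.
  have xnn : x ^+ n != 0 by rewrite expf_neq0.
  apply: is_derive1M (dF x x0) (is_derive_expnV n x0) _; rewrite exprS; field.
  by rewrite xn xnn.
- by move=> x /F0 ->; rewrite mul0r.
Qed.

Lemma wtailB L n f g t : tailfun L f -> tailfun L g -> 0 < t ->
  wtail n (f \- g) t = wtail n f t - wtail n g t.
Proof.
move=> Tf Tg; apply: (@wtail_unique L n (f \- g) (wtail n f \- wtail n g)).
- split=> x x0; first exact: continuousB (Tf.1 x x0) (Tg.1 x x0).
  by rewrite /= Tf.2 ?Tg.2 ?subr0.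
- move=> x x0; apply: is_derive1B (is_derive_wtail n x0 Tf) (is_derive_wtail n x0 Tg) _.
  by rewrite /=; ring.
- move=> x Lx /=; rewrite !wtail_eq0 ?subr0// => v /(le_trans Lx).
    exact: Tg.2.
  exact: Tf.2.
Qed.

Lemma wtailZ L n f c t : tailfun L f -> 0 < t ->
  wtail n (fun v => c * f v) t = c * wtail n f t.
Proof.
move=> Tf; apply: (@wtail_unique L n _ (fun t => c * wtail n f t)).
- split=> x x0; last by rewrite Tf.2 ?mulr0.
  by apply: continuousM; [exact: cst_continuous | exact: Tf.1].
- move=> x x0; apply: is_derive1Z (is_derive_wtail n x0 Tf) _; ring.
- by move=> x Lx; rewrite wtail_eq0 ?mulr0// => v /(le_trans Lx); exact: Tf.2.
Qed.

(* Compare with the integral of the constant [l], whose weighted tail is [l / n * (1 - (t / x) ^+ n)]. *)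
Lemma wtail_near L n f l e t x : 0 < t -> t <= x -> tailfun L f -> (0 < n)%N ->
  (forall v, t <= v <= x -> `|f v - l| <= e) ->
  `|n%:R * wtail n f t - l - (t / x) ^+ n * (n%:R * wtail n f x - l)| <= e.
Proof.
move=> t0 tx Tf n0 fe.
have x0 : 0 < x := lt_le_trans t0 tx.
have nn : (n%:R : R) != 0 by rewrite pnatr_eq0 -lt0n.
have e0 : 0 <= e by apply: le_trans (fe t _); rewrite ?lexx.
have H : `|(tail (fun v => f v / v ^+ n.+1) t - l / n%:R / t ^+ n)
      - (tail (fun v => f v / v ^+ n.+1) x - l / n%:R / x ^+ n)|
   <= e / n%:R / t ^+ n - e / n%:R / x ^+ n.
  apply: (@norm_increment_le R (fun v => tail (fun v => f v / v ^+ n.+1) v - l / n%:R / v ^+ n)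
    (fun v => - ((f v - l) / v ^+ n.+1)) (fun v => e / n%:R / v ^+ n) (fun v => e / v ^+ n.+1) t x tx).
  - move=> v /andP[tv vx]; have v0 := lt_le_trans t0 tv.
    apply: is_derive1B (is_derive_tail v0 (tailfun_weight n.+1 Tf))
      (is_derive1Z (c := l / n%:R) (is_derive_expnV n v0) erefl) _; field.
    by rewrite nn expf_neq0 ?gt_eqF.
  - move=> v /andP[tv vx]; have v0 := lt_le_trans t0 tv.
    apply: is_derive1Z (is_derive_expnV n v0) _; field.
    by rewrite nn expf_neq0 ?gt_eqF.
  - move=> v /andP[tv vx]; have v0 := lt_le_trans t0 tv.
    rewrite normrN normrM normfV (@gtr0_norm _ (v ^+ _)) ?exprn_gt0//.
    by rewrite ler_pM2r ?invr_gt0 ?exprn_gt0// fe// tv.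
have nt0 : 0 < n%:R * t ^+ n by rewrite mulr_gt0 ?ltr0n ?exprn_gt0.
have tn : t ^+ n != 0 by rewrite expf_neq0// gt_eqF.
have xn : x ^+ n != 0 by rewrite expf_neq0// gt_eqF.
move: H; rewrite -(ler_pM2l nt0) -{1}(gtr0_norm nt0) -normrM => H.
apply: le_trans (_ : e * (1 - (t / x) ^+ n) <= e); last first.
  by rewrite ler_piMr// gerBl exprn_ge0// divr_ge0// ltW.
move: H; congr (`|_| <= _); rewrite /wtail expr_div_n; field.
all: by rewrite ?nn ?tn ?xn.
Qed.

(** For [n > 0], take [l = 0] in [wtail_near] and an endpoint beyond [L], where the weighted tail
    vanishes; for [n = 0] the left side is [0]. *)
Lemma wtail_bound L n f t M : 0 < t -> tailfun L f ->
  (forall v, t <= v -> `|f v| <= M) -> `|n%:R * wtail n f t| <= M.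
Proof.
move=> t0 Tf fM.
case: (posnP n) => [->|n0].
  by rewrite mul0r normr0; apply: le_trans (fM t _).
have tx : t <= Num.max t L by rewrite le_max lexx.
have := @wtail_near L n f 0 M t (Num.max t L) t0 tx Tf n0.
rewrite (@wtail_eq0 n f (Num.max t L)); last first.
  by move=> v; rewrite ge_max => /andP[_]; exact: Tf.2.
rewrite mulr0 !subr0 mulr0 subr0; apply => v /andP[tv _].
by rewrite subr0 fM.
Qed.

(** The part of the mean beyond [x] has weight [(t / x)^n <= t / x], and there the mean differs from
    [l] by at most [2 M]. *)
Lemma wtail_near0 L n f l e M t x : 0 < t -> t <= x -> tailfun L f -> (0 < n)%N ->
  (forall v, t <= v <= x -> `|f v - l| <= e) ->
  (forall v, t <= v -> `|f v| <= M) -> `|l| <= M ->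
  `|n%:R * wtail n f t - l| <= e + 2 * M * (t / x).
Proof.
move=> t0 tx Tf n0 fe fM lM.
have x0 : 0 < x := lt_le_trans t0 tx.
have := wtail_near t0 tx Tf n0 fe; set A := _ - l; set B := _ * (_ - l) => H.
rewrite -(subrK B A) (le_trans (ler_normD _ _))// lerD//.
rewrite /B normrM [leRHS]mulrC; apply: ler_pM => //.
  have tx1 : 0 <= t / x <= 1.
    by rewrite (divr_ge0 (ltW t0) (ltW x0)) ler_pdivrMr ?mul1r.
  case/andP: tx1 => ? ?; rewrite ger0_norm ?exprn_ge0//.
  by rewrite -[leRHS]expr1 ler_wiXn2l.
rewrite (le_trans (ler_normB _ _))// [leRHS]mulr_natl mulr2n lerD//.
apply: (@wtail_bound L n f x M x0 Tf) => v /(le_trans tx); exact: fM.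
Qed.

End WeightedTail.

(** * Continuity and differentiation of integrals with a parameter *)

Section UnderIntegral.
Variable R : realType.
Notation leb := (@lebesgue_measure R).
Implicit Types (f g F : R -> R) (t x l L M K : R) (n : nat) (q : R -> R -> R).

Lemma itv_cst_integrable c d K : leb.-integrable `[c, d] (EFin \o cst K).
Proof. by apply: itv_integrable => x; exact: cst_continuous. Qed.

Lemma continuous_itv_integral q c d u v K :
  (forall x, u < x < v -> {within `[c, d], continuous (q x)}) ->
  (forall x y, u < x < v -> c <= y <= d -> {for x, continuous (q^~ y)}) ->
  (forall x y, u < x < v -> c <= y <= d -> `|q x y| <= K) ->
  forall x, u < x < v -> {for x, continuous (fun x => Rintegral leb `[c, d] (q x))}.
Proof.
move=> cq cqy qK x uxv.
have sub y : (`]u, v[%classic : set R) y -> u < y < v by rewrite /= in_itv.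
apply: (@continuity_under_integral R _ _ leb q `[c, d] _ u v _ _ (cst K)) => //.
- by move=> y /sub /cq; exact: itv_integrable.
- apply: aeW => y; rewrite /= in_itv/= => cyd z; rewrite inE => /sub uzv; exact: cqy.
- exact: itv_cst_integrable.
- by move=> y /sub uyv; apply: aeW => z; rewrite /= in_itv/=; exact: qK.
- by rewrite inE/= in_itv.
Qed.

Lemma is_derive_itv_integral q q' c d u v K :
  (forall x, u < x < v -> {within `[c, d], continuous (q x)}) ->
  (forall x y, u < x < v -> c <= y <= d -> is_derive x 1 (q^~ y) (q' x y)) ->
  (forall x y, u < x < v -> c <= y <= d -> `|q' x y| <= K) ->
  forall x, u < x < v ->
  is_derive x 1 (fun x => Rintegral leb `[c, d] (q x)) (Rintegral leb `[c, d] (q' x)).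
Proof.
move=> cq dq qK x uxv.
have sub y : (`]u, v[%classic : set R) y -> u < y < v by rewrite /= in_itv.
have cyd y : (`[c, d]%classic : set R) y -> c <= y <= d by rewrite /= in_itv.
(* An empty interval is treated apart: it contains no point from which [0 <= K] could be deduced. *)
have [dc|cd] := ltP d c.
  have e : `[c, d]%classic = set0 :> set R by rewrite set_itv_ge// bnd_simp -ltNge.
  rewrite e Rintegral_set0 (_ : (fun _ => _) = cst 0); first exact: is_derive_cst.
  by apply/funext => y; rewrite Rintegral_set0.
have K0 : 0 <= K by apply: le_trans (qK x c uxv _); rewrite ?lexx.
have d1 y z : u < y < v -> c <= z <= d -> partial1of2 q y z = q' y z.
  by move=> uyv cz; rewrite partial1of2E; case: (dq _ _ uyv cz).
have hx : (`]u, v[%classic : set R) x by rewrite /= in_itv.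
have hi y : (`]u, v[%classic : set R) y -> leb.-integrable `[c, d] (EFin \o q y).
  by move=> /sub /cq; exact: itv_integrable.
have hd y z : (`]u, v[%classic : set R) y -> (`[c, d]%classic : set R) z ->
    derivable (q^~ z) y 1.
  by move=> /sub hy /cyd hz; case: (dq _ _ hy hz).
have hK y z : (`]u, v[%classic : set R) y -> (`[c, d]%classic : set R) z ->
    `|partial1of2 q y z| <= cst K z.
  by move=> /sub hy /cyd hz; rewrite d1//; exact: qK.
have mI : measurable (`[c, d]%classic : set R) by exact: measurable_itv.
apply: DeriveDef.
  by apply: (@derivable_under_integral R _ _ leb q `[c, d] mI x u v hx hi hd (cst K)) => //;
    exact: itv_cst_integrable.
rewrite -derive1E (@differentiation_under_integral R _ _ leb q `[c, d] mI x u v hx hi hd (cst K)) //.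
  by apply: eq_Rintegral => y; rewrite inE => /cyd cy; rewrite d1.
exact: itv_cst_integrable.
Qed.

(** All [q x] vanish beyond the same [L], so the tail is an integral over a fixed compact interval,
    where [M / t^(n+1)] dominates the integrand. *)
Lemma continuous_wtail L n q t u v M : 0 < t ->
  (forall x, u < x < v -> tailfun L (q x)) ->
  (forall x y, u < x < v -> t <= y -> {for x, continuous (q^~ y)}) ->
  (forall x y, u < x < v -> t <= y -> `|q x y| <= M) ->
  forall x, u < x < v -> {for x, continuous (fun x => wtail n (q x) t)}.
Proof.
move=> t0 Tq cq qM x uxv.
apply: continuousM; first exact: cst_continuous.
set m := Num.max t L.
have tm : t <= m by rewrite le_max lexx.
have Lm : L <= m by rewrite le_max lexx orbT.
have Tw y : u < y < v -> tailfun L (fun w => q y w / w ^+ n.+1).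
  by move=> /Tq; exact: tailfun_weight.
have : {for x, continuous (fun x => Rintegral leb `[t, m] (fun w => q x w / w ^+ n.+1))}.
  apply: (@continuous_itv_integral _ _ _ u v (M / t ^+ n.+1)) => //.
  - by move=> y /Tw; exact: tailfun_within.
  - move=> y z uyv /andP[tz _]; apply: continuousM; first exact: cq.
    exact: cst_continuous.
  - move=> y z uyv /andP[tz _]; rewrite normrM ler_pM ?qM//.
    have z0 : 0 < z := lt_le_trans t0 tz.
    rewrite normfV (gtr0_norm (exprn_gt0 _ z0)) lef_pV2 ?posrE ?exprn_gt0//.
    by rewrite lerXn2r// nnegrE ltW.
rewrite /prop_for /continuous_at (tail_itv t0 tm Lm (Tw _ uxv)).
apply: cvg_trans; apply: near_eq_cvg; near=> y.
rewrite (tail_itv t0 tm Lm (Tw _ _))//; apply/andP; split; near: y.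
  by apply: lt_nbhsr; case/andP: uxv.
by apply: lt_nbhsl; case/andP: uxv.
Unshelve. all: by end_near. Qed.

(** Same truncation as in [continuous_wtail], with the domination now on the derivative [q']. *)
Lemma is_derive_wtail_param L n q q' t u v M : 0 < t ->
  (forall x, u < x < v -> tailfun L (q x)) ->
  (forall x y, u < x < v -> t <= y -> is_derive x 1 (q^~ y) (q' x y)) ->
  (forall x, u < x < v -> tailfun L (q' x)) ->
  (forall x y, u < x < v -> t <= y -> `|q' x y| <= M) ->
  forall x, u < x < v -> is_derive x 1 (fun x => wtail n (q x) t) (wtail n (q' x) t).
Proof.
move=> t0 Tq cq Tq' qM x uxv.
apply: is_derive1Z; last reflexivity.
set m := Num.max t L.
have tm : t <= m by rewrite le_max lexx.
have Lm : L <= m by rewrite le_max lexx orbT.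
have Tw y : u < y < v -> tailfun L (fun w => q y w / w ^+ n.+1).
  by move=> /Tq; exact: tailfun_weight.
rewrite (tail_itv t0 tm Lm (tailfun_weight n.+1 (Tq' _ uxv))).
have : is_derive x 1 (fun x => Rintegral leb `[t, m] (fun w => q x w / w ^+ n.+1))
    (Rintegral leb `[t, m] (fun w => q' x w / w ^+ n.+1)).
  apply: (@is_derive_itv_integral _ (fun y w => q' y w / w ^+ n.+1) _ _ u v (M / t ^+ n.+1)) => //.
  - by move=> y /Tw; exact: tailfun_within.
  - move=> y z uyv /andP[tz _].
    apply: is_derive1M (cq _ _ uyv tz) (is_derive_cst _ _ _) _.
    by rewrite mulr0 addr0.
  - move=> y z uyv /andP[tz _]; rewrite normrM ler_pM ?qM//.
    have z0 : 0 < z := lt_le_trans t0 tz.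
    rewrite normfV (gtr0_norm (exprn_gt0 _ z0)) lef_pV2 ?posrE ?exprn_gt0//.
    by rewrite lerXn2r// nnegrE ltW.
apply: near_eq_is_derive; near=> y.
rewrite (tail_itv t0 tm Lm (Tw _ _))//; apply/andP; split; near: y.
  by apply: lt_nbhsr; case/andP: uxv.
by apply: lt_nbhsl; case/andP: uxv.
Unshelve. all: by end_near. Qed.

End UnderIntegral.

(** * The transform of a function on the plane *)

Section Plane.
Variable R : realType.
Implicit Types (f g F : R -> R) (s t x l L M K : R) (n a b : nat) (phi q : R -> R -> R).

(** Away from the origin only separate continuity is recorded; a joint limit is asked at the origin
    alone, from within the quadrant. The domain is the whole plane, so that the axes can be
    approached by ordinary two-sided limits. *)
Record planefun L M phi : Prop := Planefun {
  planefun_cont1 : forall v, continuous (phi^~ v);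
  planefun_cont2 : forall u, continuous (phi u);
  planefun_eq01 : forall u v, L <= u -> phi u v = 0;
  planefun_eq02 : forall u v, L <= v -> phi u v = 0;
  planefun_le : forall u v, `|phi u v| <= M;
  planefun_cvg0 : forall e, 0 < e -> exists2 d, 0 < d &
    forall u v, 0 <= u <= d -> 0 <= v <= d -> `|phi u v - phi 0 0| <= e }.

Definition swap phi : R -> R -> R := fun u v => phi v u.

Lemma planefun_swap L M phi : planefun L M phi -> planefun L M (swap phi).
Proof.
case=> c1 c2 z1 z2 le c0; split=> //.
- by move=> u v; exact: z2.
- by move=> u v; exact: z1.
- by move=> u v; exact: le.
- by move=> e /c0[d d0 H]; exists d => // u v ? ?; exact: H.
Qed.

(** For positive [s] and [t] this is the function differentiated in [Stilde], as shown inside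
    [StildeE]. *)
Definition wtail2 a b phi s t := wtail b (fun v => wtail a (phi^~ v) s) t.

(* [mixed] is [s t d_s d_t] of [wtail2], hence [s ^ a * t ^ b] times [Stilde]. *)
Definition mixed a b phi s t :=
  a%:R * b%:R * wtail2 a b phi s t - b%:R * wtail b (phi s) t
  - a%:R * wtail a (phi^~ t) s + phi s t.

Section Fixed.
Variables (L M : R) (phi : R -> R -> R).
Hypothesis Pphi : planefun L M phi.

Lemma planefun_tailfun1 v : tailfun L (phi^~ v).
Proof. by split=> [x _|x Lx]; [exact: (planefun_cont1 Pphi)|exact: (planefun_eq01 Pphi)]. Qed.

Lemma planefun_tailfun2 u : tailfun L (phi u).
Proof. by split=> [x _|x Lx]; [exact: (planefun_cont2 Pphi)|exact: (planefun_eq02 Pphi)]. Qed.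

Lemma wtail1_continuous a s : 0 < s -> continuous (fun v => wtail a (phi^~ v) s).
Proof.
move=> s0 x; apply: (@continuous_wtail R L a (swap phi) s (x - 1) (x + 1) M) => //.
- by move=> v _; exact: planefun_tailfun1.
- by move=> v u _ _; exact: (planefun_cont2 Pphi).
- by move=> v u _ _; exact: (planefun_le Pphi).
- by apply/andP; split; lra.
Qed.

Lemma wtail1_tailfun a s : 0 < s -> tailfun L (fun v => wtail a (phi^~ v) s).
Proof.
move=> s0; split=> [x _|x Lx]; first exact: wtail1_continuous.
by apply: wtail_eq0 => u _; exact: (planefun_eq02 Pphi).
Qed.

Lemma wtail1_bound a s v : 0 < s -> `|a%:R * wtail a (phi^~ v) s| <= M.
Proof.
move=> s0; apply: (@wtail_bound R L) => //; first exact: planefun_tailfun1.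
by move=> u _; exact: (planefun_le Pphi).
Qed.

Lemma wtail2_bound a b s t : 0 < s -> 0 < t -> `|a%:R * b%:R * wtail2 a b phi s t| <= M.
Proof.
move=> s0 t0; rewrite (mulrC a%:R) -mulrA -(wtailZ b a%:R (wtail1_tailfun a s0) t0).
apply: (@wtail_bound R L) => //; last by move=> v _; exact: wtail1_bound.
split=> [x x0|x Lx]; last by rewrite (wtail1_tailfun a s0).2 ?mulr0.
by apply: continuousM; [exact: cst_continuous|exact: wtail1_continuous].
Qed.

Lemma is_derive_wtail2r a b s t : 0 < s -> 0 < t ->
  is_derive t 1 (wtail2 a b phi s) ((b%:R * wtail2 a b phi s t - wtail a (phi^~ t) s) / t).
Proof. by move=> s0 t0; exact: (is_derive_wtail b t0 (wtail1_tailfun a s0)). Qed.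

(** Here the variable sits in the inner tail: the Euler equation is applied under the outer tail,
    and linearity then reassembles the result. *)
Lemma is_derive_wtail2l a b s t : 0 < s -> 0 < t ->
  is_derive s 1 (fun s => wtail2 a b phi s t)
    ((a%:R * wtail2 a b phi s t - wtail b (phi s) t) / s).
Proof.
move=> s0 t0.
have M0 : 0 <= M by apply: le_trans (planefun_le Pphi 0 0).
have Tq x : 0 < x -> tailfun L (fun v => a%:R * wtail a (phi^~ v) x).
  move=> x0; split=> [y y0|y Ly]; last by rewrite (wtail1_tailfun a x0).2 ?mulr0.
  by apply: continuousM; [exact: cst_continuous|exact: wtail1_continuous].
have TB x : 0 < x -> tailfun L (fun v => a%:R * wtail a (phi^~ v) x - phi x v).
  move=> x0; split=> [y y0|y Ly].
    by apply: continuousB; [exact: (Tq _ x0).1|exact: (planefun_cont2 Pphi)].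
  by rewrite (Tq _ x0).2 // (planefun_eq02 Pphi)// subr0.
have TC x : 0 < x -> tailfun L (fun v => x^-1 * (a%:R * wtail a (phi^~ v) x - phi x v)).
  move=> x0; split=> [y y0|y Ly]; last by rewrite (TB _ x0).2 ?mulr0.
  by apply: continuousM; [exact: cst_continuous|exact: (TB _ x0).1].
suff : is_derive s 1 (fun s => wtail2 a b phi s t)
    (wtail b (fun v => s^-1 * (a%:R * wtail a (phi^~ v) s - phi s v)) t).
  rewrite (wtailZ _ _ (TB _ s0) t0) (wtailB _ (Tq _ s0) (planefun_tailfun2 s) t0).
  by rewrite (wtailZ _ _ (wtail1_tailfun a s0) t0) mulrC.
(* On the window []s / 2, s + 1[] the inverse is at most [(s / 2)^-1], and the two terms in the
   bracket are at most [M] each. *)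
apply: (@is_derive_wtail_param R L b (fun s v => wtail a (phi^~ v) s)
  (fun s v => s^-1 * (a%:R * wtail a (phi^~ v) s - phi s v))
  t (s / 2) (s + 1) ((s / 2)^-1 * (M + M))) => //.
- by move=> x /andP[sx _]; apply: wtail1_tailfun; lra.
- move=> x y /andP[sx _] _; have x0 : 0 < x by lra.
  by rewrite mulrC; apply: is_derive_wtail x0 (planefun_tailfun1 y).
- by move=> x /andP[sx _]; apply: TC; lra.
- move=> x y /andP[sx _] _; have x0 : 0 < x by lra.
  rewrite normrM ler_pM//.
    by rewrite normfV gtr0_norm// lef_pV2 ?posrE; lra.
  by rewrite (le_trans (ler_normB _ _))// lerD ?wtail1_bound ?(planefun_le Pphi).
- by apply/andP; split; lra.
Qed.

End Fixed.

(* Fubini: both sides solve the same differential equation in [s] and vanish for large [s]. *)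
Lemma wtail2_swap L M phi a b s t : planefun L M phi -> 0 < s -> 0 < t ->
  wtail2 a b phi s t = wtail2 b a (swap phi) t s.
Proof.
move=> Pphi s0 t0; apply/esym.
apply: (@wtail_unique R L a (fun u => wtail b (phi u) t) (fun s => wtail2 a b phi s t)) => //.
- exact: (wtail1_tailfun (planefun_swap Pphi) b t0).
- by move=> x x0; exact: is_derive_wtail2l Pphi _ _ _ _ x0 t0.
- move=> x Lx; apply: wtail_eq0 => v _; apply: wtail_eq0 => u /(le_trans Lx).
  exact: (planefun_eq01 Pphi).
Qed.

Lemma mixed_swap L M phi a b s t : planefun L M phi -> 0 < s -> 0 < t ->
  mixed a b phi s t = mixed b a (swap phi) t s.
Proof. by move=> Pphi s0 t0; rewrite /mixed (wtail2_swap _ _ Pphi s0 t0) /swap; ring. Qed.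

Lemma mixed_bound L M phi a b s t : planefun L M phi -> 0 < s -> 0 < t ->
  `|mixed a b phi s t| <= 4 * M.
Proof.
move=> Pphi s0 t0; rewrite /mixed.
have h1 := wtail2_bound Pphi a b s0 t0.
have h2 := wtail1_bound (planefun_swap Pphi) b s t0.
have h3 := wtail1_bound Pphi a t s0.
have h4 := planefun_le Pphi s t.
rewrite /swap in h2.
move: h1 h2 h3 h4; rewrite !ler_norml => /andP[? ?] /andP[? ?] /andP[? ?] /andP[? ?].
by apply/andP; split; lra.
Qed.

(** Every term of [mixed] only involves values of [phi] on the quarter plane with corner
    [(s, t)]. *)
Lemma mixed_eq0 phi a b s t :
  (forall u v, s <= u -> t <= v -> phi u v = 0) -> mixed a b phi s t = 0.
Proof.
move=> H; rewrite /mixed /wtail2 !wtail_eq0 ?mulr0 ?subr0 ?add0r ?H//.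
- by move=> u su; exact: H.
- by move=> v tv; exact: H.
- by move=> v tv; apply: wtail_eq0 => u su; exact: H.
Qed.

(* [slope] is [s d_s] of [wtail2]. *)
Definition slope a b phi s t := a%:R * wtail2 a b phi s t - wtail b (phi s) t.

Lemma is_derive_slope L M phi a b s t : planefun L M phi -> 0 < s -> 0 < t ->
  is_derive t 1 (slope a b phi s) (mixed a b phi s t / t).
Proof.
move=> Pphi s0 t0.
apply: is_derive1B (is_derive1Z (is_derive_wtail2r Pphi a b s0 t0) erefl)
  (is_derive_wtail b t0 (planefun_tailfun2 Pphi s)) _.
by rewrite /mixed; ring.
Qed.

Lemma lipschitz_of_derive f df K t0 t x :
  (forall v, t0 <= v -> is_derive v 1 f (df v)) ->
  (forall v, t0 <= v -> `|df v| <= K) -> t0 <= t -> t0 <= x ->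
  `|f t - f x| <= K * `|t - x|.
Proof.
move=> fdf dfK.
wlog tx : t x / t <= x.
  move=> H ht hx; case: (leP t x) => [tx|/ltW xt]; first exact: H.
  by rewrite distrC (distrC t); apply: H.
move=> ht hx; have lt v : t <= v <= x -> t0 <= v by case/andP => /(le_trans ht).
have := @norm_increment_le R f df (fun v => - K * v) (cst K) t x tx.
rewrite distrC (distrC t) (ger0_norm (_ : 0 <= x - t)) ?subr_ge0//.
rewrite (_ : K * (x - t) = - K * t - - K * x); last by ring.
rewrite distrC; apply.
- by move=> v /lt /fdf.
- move=> v _; apply: is_derive1Z (is_derive_id _ _) _; rewrite /cst; ring.
- by move=> v /lt /dfK.
Qed.

(** By the Caratheodory criterion with the quotient [f z / (z - x)]; its value at [z = x] is [0],
    since the inverse of [0] is [0], which is the required derivative. *)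
Lemma is_derive_quadratic f x K : (\forall y \near x, `|f y| <= K * (y - x) ^+ 2) ->
  is_derive x 1 f 0.
Proof.
move=> H; have fx : f x = 0.
  apply/eqP; rewrite -normr_le0; have := nbhs_singleton H.
  by rewrite subrr expr0n mulr0.
apply/is_derive1_caratheodory; exists (fun z => f z / (z - x)); split.
- move=> z; rewrite fx subr0; have [->|zx] := eqVneq z x; first by rewrite fx !mul0r.
  by rewrite mulfVK// subr_eq0.
- rewrite /prop_for /continuous_at subrr invr0 mulr0.
  apply/cvgr0Pnorm_le => e e0; near=> z.
  have [->|zx] := eqVneq z x; first by rewrite subrr invr0 mulr0 normr0 ltW.
  have zx0 : 0 < `|z - x| by rewrite normr_gt0 subr_eq0.
  rewrite normrM normfV ler_pdivrMr//.
  have h1 : `|f z| <= K * (z - x) ^+ 2 by near: z.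
  apply: (le_trans h1).
  rewrite -[(z - x) ^+ 2]ger0_norm ?sqr_ge0// normrX expr2 mulrA ler_pM2r//.
  apply: (@le_trans _ _ (`|K| * `|z - x|)); first by rewrite ler_pM2r// ler_norm.
  (* Adding [1] keeps the divisor of [e] positive even if [K = 0]. *)
  have K1 : 0 < `|K| + 1 by rewrite ltr_wpDl.
  apply: (@le_trans _ _ ((`|K| + 1) * `|z - x|)); first by rewrite ler_pM2r// lerDl.
  rewrite mulrC -ler_pdivlMr// distrC; near: z.
  by apply: cvgr_dist_le; [exact: cvg_id | rewrite divr_gt0].
- by rewrite subrr invr0 mulr0.
Unshelve. all: by end_near. Qed.

(* The second difference [F y y - F y x - F x y + F x x] is [O((y - x)^2)]. *)
Lemma is_derive_diagonal q (dq ddq : R -> R -> R) K x l : 0 < x ->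
  (forall s t, 0 < s -> 0 < t -> is_derive s 1 (q^~ t) (dq s t)) ->
  (forall s t, 0 < s -> 0 < t -> is_derive t 1 (dq s) (ddq s t)) ->
  (forall s t, x / 2 <= s -> x / 2 <= t -> `|ddq s t| <= K) ->
  is_derive x 1 (q x) l -> is_derive x 1 (fun y => q y y) (dq x x + l).
Proof.
move=> x0 Dq Ddq Kq qxl.
have x20 : 0 < x / 2 by lra.
pose E y := (q y y - q y x) - (q x y - q x x).
have E0 : is_derive x 1 E 0.
  apply: (@is_derive_quadratic _ _ K); near=> y.
  have y2 : x / 2 <= y by apply/ltW; near: y; apply: lt_nbhsr; lra.
  have y0 : 0 < y by lra.
  have x2x : x / 2 <= x by lra.
  rewrite -[(y - x) ^+ 2]ger0_norm ?sqr_ge0// normrX expr2 mulrA.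
  (* The mean value inequality is used twice: in [s] here, with constant [K |y - x|], which itself
     comes from the inequality in [t] for [dq s]. *)
  apply: (@lipschitz_of_derive (fun s => q s y - q s x) (fun s => dq s y - dq s x)
    _ (x / 2)) => //.
    move=> s hs; have s0 : 0 < s by lra.
    exact: is_derive1B (Dq _ _ s0 y0) (Dq _ _ s0 x0) erefl.
  move=> s hs; have s0 : 0 < s by lra.
  apply: (@lipschitz_of_derive (dq s) (ddq s) K (x / 2)) => //.
    by move=> t ht; apply: Ddq; lra.
  by move=> t ht; exact: Kq.
have H := is_derive1D E0 (is_derive1D (Dq x x x0 x0) qxl erefl) (add0r _).
have -> : (fun y => q y y) = (fun y => E y + (q y x + q x y) - cst (q x x) y).
  by apply/funext => y; rewrite /E /cst; ring.
exact: is_derive1B H (is_derive_cst (q x x) x 1) (subr0 _).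
Unshelve. all: by end_near. Qed.

(** The bound on [mixed] controls the second mixed derivative on [[s / 2, oo)^2], so
    [is_derive_diagonal] gives the sum of the two partial derivatives. *)
Lemma is_derive_wtail2_diag L M phi a b s : planefun L M phi -> 0 < s ->
  is_derive s 1 (fun s => wtail2 a b phi s s)
    ((slope a b phi s s + slope b a (swap phi) s s) / s).
Proof.
move=> Pphi s0.
have := @is_derive_diagonal (wtail2 a b phi) (fun s t => slope a b phi s t / s)
  (fun s t => mixed a b phi s t / t / s) (4 * M / (s / 2) / (s / 2)) s _ s0.
move=> /(_ _ _ _ _ (is_derive_wtail2r Pphi a b s0 s0)) H.
apply: is_derive_eq (H _ _ _) _.
- by move=> x t x0 t0; exact: (is_derive_wtail2l Pphi a b x0 t0).
- move=> x t x0 t0; apply: is_derive1M (is_derive_slope a b Pphi x0 t0) (is_derive_cst _ _ _) _.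
  by rewrite mulr0 addr0.
- move=> x t hx ht; have x0 : 0 < x by lra.
  have t0 : 0 < t by lra.
  have s20 : 0 < s / 2 by lra.
  rewrite !normrM !normfV (gtr0_norm x0) (gtr0_norm t0).
  have xi : 0 <= x^-1 <= (s / 2)^-1 by rewrite invr_ge0 (ltW x0) lef_pV2 ?posrE.
  have ti : 0 <= t^-1 <= (s / 2)^-1 by rewrite invr_ge0 (ltW t0) lef_pV2 ?posrE.
  case/andP: xi => xi xi'; case/andP: ti => ti ti'.
  apply: ler_pM => //; first exact: mulr_ge0.
  by apply: ler_pM => //; exact: (mixed_bound a b Pphi x0 t0).
- rewrite -mulrDl; congr (_ / _); congr (_ + _).
  by rewrite /slope -(wtail2_swap a b Pphi s0 s0) mulrC.
Qed.

End Plane.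

(** * The radial profile of the transform *)

Section Profile.
Variable R : realType.
Implicit Types (f g F zeta : R -> R) (s t x l L M K e d : R) (n a b : nat) (phi q : R -> R -> R).

(** Half of [e] comes from the values near [0], half from the remainder [2 M t / d] of
    [wtail_near0]. The threshold depends on [M], [e] and [d] only, hence is uniform over families of
    functions; [M + 1] avoids dividing by [0]. *)
Lemma wtail_cvg0 L n f l M e d t : (0 < n)%N -> tailfun L f ->
  (forall v, `|f v| <= M) -> `|l| <= M -> 0 < e -> 0 < d ->
  (forall v, 0 < v <= d -> `|f v - l| <= e / 2) ->
  0 < t <= d * Num.min 1 (e / (4 * (M + 1))) -> `|n%:R * wtail n f t - l| <= e.
Proof.
move=> n0 Tf fM lM e0 d0 fe /andP[t0 td].
have M0 : 0 <= M by apply: le_trans lM.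
have M4 : 0 < 4 * (M + 1) by lra.
have td1 : t <= d.
  by apply: le_trans td _; apply: ler_piMr; rewrite ?(ltW d0)// ge_min lexx.
have td2 : t / d <= e / (4 * (M + 1)).
  rewrite ler_pdivrMr// mulrC; apply: le_trans td _.
  by rewrite ler_pM2l// ge_min lexx orbT.
have fe' v : t <= v <= d -> `|f v - l| <= e / 2.
  by move=> /andP[tv vd]; apply: fe; rewrite (lt_le_trans t0 tv).
apply: le_trans (@wtail_near0 R L n f l (e / 2) M t d t0 td1 Tf n0 fe' (fun v _ => fM v) lM) _.
have : 2 * M * (t / d) <= 2 * (M + 1) * (e / (4 * (M + 1))).
  by apply: ler_pM => //; [lra|rewrite divr_ge0 ?ltW|lra].
rewrite (_ : 2 * (M + 1) * (e / (4 * (M + 1))) = e / 2); first lra.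
by field; lra.
Qed.

Lemma wtail_planefun_cvg0 L M phi b e : planefun L M phi -> (0 < b)%N -> 0 < e ->
  exists2 d, 0 < d & forall u t, 0 <= u <= d -> 0 < t <= d ->
    `|b%:R * wtail b (phi u) t - phi 0 0| <= e.
Proof.
move=> Pphi b0 e0.
have M0 : 0 <= M by apply: le_trans (planefun_le Pphi 0 0).
have e20 : 0 < e / 2 by lra.
have [d d0 Hd] := planefun_cvg0 Pphi e20.
have m0 : 0 < Num.min 1 (e / (4 * (M + 1))).
  by rewrite lt_min ltr01 divr_gt0//; lra.
have md : d * Num.min 1 (e / (4 * (M + 1))) <= d by apply: ler_piMr; rewrite ?(ltW d0)// ge_min lexx.
exists (d * Num.min 1 (e / (4 * (M + 1)))); first by rewrite mulr_gt0.
move=> u t /andP[u0 ud] td.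
apply: (@wtail_cvg0 L b (phi u) (phi 0 0) M e d) => //.
- exact: planefun_tailfun2 Pphi u.
- exact: planefun_le Pphi u.
- exact: (planefun_le Pphi).
- move=> v /andP[v0 vd]; apply: Hd; first by rewrite u0 (le_trans ud).
  by rewrite ltW.
Qed.

(** With [p u = b * wtail b (phi u) s - phi u s], [mixed] on the diagonal is
    [a * wtail a p s - p s]. Both terms of [p] are close to [phi 0 0] when [u] and [s] are small, so
    [p] is small there and so is its average. *)
Lemma mixed_cvg0_right L M phi a b e : planefun L M phi -> (0 < b)%N -> 0 < e ->
  exists2 d, 0 < d & forall s, 0 < s <= d -> `|mixed a b phi s s| <= e.
Proof.
move=> Pphi b0 e0.
have M0 : 0 <= M by apply: le_trans (planefun_le Pphi 0 0).
have e80 : 0 < e / 8 by lra.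
have e20 : 0 < e / 2 by lra.
have [d1 d10 H1] := wtail_planefun_cvg0 Pphi b0 e80.
have [d2 d20 H2] := planefun_cvg0 Pphi e80.
pose d := Num.min d1 d2.
have d0 : 0 < d by rewrite lt_min d10.
have m0 : 0 < Num.min 1 (e / 2 / (4 * ((M + M) + 1))).
  by rewrite lt_min ltr01 divr_gt0//; lra.
have md : d * Num.min 1 (e / 2 / (4 * ((M + M) + 1))) <= d.
  by apply: ler_piMr; rewrite ?(ltW d0)// ge_min lexx.
exists (d * Num.min 1 (e / 2 / (4 * ((M + M) + 1)))); first by rewrite mulr_gt0.
move=> s /[dup] sd' /andP[s0 sd].
have {}sd : s <= d by apply: le_trans md.
have sd1 : s <= d1 by apply: le_trans sd _; rewrite ge_min lexx.
have sd2 : s <= d2 by apply: le_trans sd _; rewrite ge_min lexx orbT.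
(* [p] depends on [s], but the threshold for [s] was fixed beforehand from the bound [M + M] and the
   radius [d]. *)
pose p u := b%:R * wtail b (phi u) s - phi u s.
have Tw := wtail1_tailfun (planefun_swap Pphi) b s0.
have Tbw : tailfun L (fun u => b%:R * wtail b (phi u) s).
  split=> [x x0|x Lx]; last by rewrite Tw.2 ?mulr0.
  by apply: continuousM; [exact: cst_continuous|exact: Tw.1].
have Tp : tailfun L p.
  split=> [x x0|x Lx].
    by apply: continuousB; [exact: Tbw.1|exact: (planefun_cont1 Pphi)].
  by rewrite /p Tbw.2// (planefun_eq01 Pphi)// subr0.
have pM u : `|p u| <= M + M.
  rewrite (le_trans (ler_normB _ _))// lerD ?(planefun_le Pphi)//.
  exact: (wtail1_bound (planefun_swap Pphi) b u s0).
have pe u : 0 < u <= d -> `|p u - 0| <= e / 2 / 2.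
  move=> /andP[u0 ud].
  have ud1 : u <= d1 by apply: le_trans ud _; rewrite ge_min lexx.
  have ud2 : u <= d2 by apply: le_trans ud _; rewrite ge_min lexx orbT.
  have h1 : `|b%:R * wtail b (phi u) s - phi 0 0| <= e / 8.
    by apply: H1; rewrite ?(ltW u0) ?s0.
  have h2 : `|phi u s - phi 0 0| <= e / 8 by apply: H2; rewrite ?(ltW u0) ?(ltW s0).
  move: h1 h2; rewrite !ler_norml /p => /andP[? ?] /andP[? ?].
  by apply/andP; split; lra.
have -> : mixed a b phi s s = a%:R * wtail a p s - p s.
  rewrite /mixed (wtailB a Tbw (planefun_tailfun1 Pphi s) s0) (wtailZ a b%:R Tw s0).
  by rewrite (wtail2_swap a b Pphi s0 s0) /wtail2 /swap /p; ring.
have h1 : `|a%:R * wtail a p s - 0| <= e / 2.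
  case: (posnP a) => [->|a0]; first by rewrite mul0r subr0 normr0 ltW.
  apply: (@wtail_cvg0 L a p 0 (M + M) (e / 2) d) => //.
  by rewrite normr0 addr_ge0.
have h2 : `|p s - 0| <= e / 2 / 2 by apply: pe; rewrite s0.
move: h1 h2; rewrite !subr0 !ler_norml => /andP[? ?] /andP[? ?].
by apply/andP; split; lra.
Qed.

Lemma mixed_cvg0 L M phi a b e : planefun L M phi -> (0 < a + b)%N -> 0 < e ->
  exists2 d, 0 < d & forall s, 0 < s <= d -> `|mixed a b phi s s| <= e.
Proof.
move=> Pphi; rewrite addn_gt0 orbC => /orP[b0|a0] e0.
  exact: mixed_cvg0_right Pphi b0 e0.
have [d d0 H] := mixed_cvg0_right b (planefun_swap Pphi) a0 e0.
exists d => // s sd; rewrite (mixed_swap a b Pphi); first exact: H.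
  by case/andP: sd.
by case/andP: sd.
Qed.

Lemma mixed_continuous L M phi a b s t : planefun L M phi -> 0 < s -> 0 < t ->
  {for s, continuous (fun s => mixed a b phi s t)}.
Proof.
move=> Pphi s0 t0.
apply: (@continuousD _ _ _ (fun s => a%:R * b%:R * wtail2 a b phi s t - b%:R * wtail b (phi s) t
  - a%:R * wtail a (phi^~ t) s) (phi^~ t)); last exact: (planefun_cont1 Pphi).
apply: (@continuousB _ _ _ (fun s => a%:R * b%:R * wtail2 a b phi s t - b%:R * wtail b (phi s) t)
  (fun s => a%:R * wtail a (phi^~ t) s)).
  apply: (@continuousB _ _ _ (fun s => a%:R * b%:R * wtail2 a b phi s t)
    (fun s => b%:R * wtail b (phi s) t)).
    apply: continuousM; first exact: cst_continuous.
    exact: is_derive1_continuous (is_derive_wtail2l Pphi a b s0 t0).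
  apply: continuousM; first exact: cst_continuous.
  exact: ((wtail1_tailfun (planefun_swap Pphi) b t0).1 s s0).
apply: continuousM; first exact: cst_continuous.
exact: is_derive1_continuous (is_derive_wtail a s0 (planefun_tailfun1 Pphi t)).
Qed.

(** Stated as a relation linear in the pair [(phi, zeta)], so that it also applies to
    differences. *)
Definition profile a b phi zeta := forall s t, 0 < s -> 0 < t ->
  zeta (Num.sqrt (s ^+ 2 + t ^+ 2)) = mixed a b phi s t / (s ^+ a * t ^+ b).

Lemma profile_swap L M a b phi zeta : planefun L M phi ->
  profile a b phi zeta -> profile b a (swap phi) zeta.
Proof.
move=> Pphi Hz s t s0 t0; rewrite addrC Hz// (mixed_swap a b Pphi t0 s0).
by rewrite (mulrC (t ^+ a)).
Qed.

Section FixedProfile.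
Variables (L M : R) (phi : R -> R -> R) (a b : nat) (zeta : R -> R).
Hypotheses (Pphi : planefun L M phi) (L0 : 0 < L) (Hz : profile a b phi zeta).
Hypothesis ball0 : forall u v, 0 < u -> 0 < v -> L ^+ 2 <= u ^+ 2 + v ^+ 2 -> phi u v = 0.

Let sqrt2_gt0 : 0 < Num.sqrt 2 :> R. Proof. by rewrite sqrtr_gt0. Qed.

Lemma sqrt_diag t : 0 < t ->
  Num.sqrt ((t / Num.sqrt 2) ^+ 2 + (t / Num.sqrt 2) ^+ 2) = t.
Proof.
move=> t0; rewrite -[RHS](gtr0_norm t0) -sqrtr_sqr; congr Num.sqrt.
by rewrite expr_div_n sqr_sqrtr//; lra.
Qed.

(** The diagonal point of radius [t] has coordinates [t / sqrt 2], whence the power of [sqrt 2]. *)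
Lemma profile_diag t : 0 < t ->
  t ^+ (a + b) * zeta t = Num.sqrt 2 ^+ (a + b) * mixed a b phi (t / Num.sqrt 2) (t / Num.sqrt 2).
Proof.
move=> t0; have s0 : 0 < t / Num.sqrt 2 by rewrite divr_gt0.
rewrite -{2}(sqrt_diag t0) Hz// -exprD expr_div_n; field.
by rewrite !expf_neq0 ?gt_eqF.
Qed.

Lemma profile_bound t : 0 < t -> t ^+ (a + b) * `|zeta t| <= 4 * Num.sqrt 2 ^+ (a + b) * M.
Proof.
move=> t0; have s0 : 0 < t / Num.sqrt 2 by rewrite divr_gt0.
rewrite -{1}(gtr0_norm (exprn_gt0 (a + b) t0)) -normrM profile_diag// normrM.
rewrite gtr0_norm ?exprn_gt0// (mulrC 4) -mulrA ler_pM2l ?exprn_gt0//.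
exact: (mixed_bound a b Pphi).
Qed.

Lemma profile_cvg0 e : (0 < a + b)%N -> 0 < e ->
  exists2 d, 0 < d & forall t, 0 < t <= d -> t ^+ (a + b) * `|zeta t| <= e.
Proof.
move=> ab0 e0; have c0 : 0 < Num.sqrt 2 ^+ (a + b) :> R by rewrite exprn_gt0.
have [d d0 H] := mixed_cvg0 Pphi ab0 (divr_gt0 e0 c0).
exists (d * Num.sqrt 2); first by rewrite mulr_gt0.
move=> t /andP[t0 td].
rewrite -{1}(gtr0_norm (exprn_gt0 (a + b) t0)) -normrM profile_diag// normrM.
rewrite gtr0_norm// mulrC -ler_pdivlMr//; apply: H.
by rewrite divr_gt0//= ler_pdivrMr.
Qed.

(** The quarter plane with corner at the diagonal point of radius [t] lies outside the open ball of
    radius [t], so [phi] vanishes on it. *)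
Lemma profile_eq0 t : L <= t -> zeta t = 0.
Proof.
move=> Lt; have t0 : 0 < t := lt_le_trans L0 Lt.
have s0 : 0 < t / Num.sqrt 2 by rewrite divr_gt0.
rewrite -(sqrt_diag t0) Hz// mixed_eq0 ?mul0r// => u v su sv.
apply: ball0; [exact: lt_le_trans su|exact: lt_le_trans sv|].
have e : t ^+ 2 = (t / Num.sqrt 2) ^+ 2 + (t / Num.sqrt 2) ^+ 2.
  by rewrite expr_div_n sqr_sqrtr//; lra.
apply: (@le_trans _ _ (t ^+ 2)); first by rewrite lerXn2r// nnegrE ltW.
by rewrite e lerD// lerXn2r// nnegrE ltW// (lt_le_trans s0).
Qed.

(** The second coordinate is frozen at [u = t / sqrt 2] and the radius [r] is reached by the first
    coordinate [sqrt (r^2 - u^2)]; continuity of [mixed] in one variable then suffices. *)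
Lemma profile_continuous t : 0 < t -> {for t, continuous zeta}.
Proof.
move=> t0; set u := t / Num.sqrt 2.
have u0 : 0 < u by rewrite divr_gt0.
have ut : u < t.
  rewrite ltr_pdivrMr// ltr_pMr// -[ltLHS](sqrtr1 R) ltr_sqrt//; lra.
have eu : Num.sqrt (t ^+ 2 - u ^+ 2) = u.
  rewrite -[RHS](gtr0_norm u0) -sqrtr_sqr; congr Num.sqrt.
  by rewrite /u expr_div_n sqr_sqrtr//; lra.
pose h := Num.sqrt \o (fun r => r ^+ 2 - u ^+ 2).
pose g s := mixed a b phi s u / (s ^+ a * u ^+ b).
have ch : {for t, continuous h}.
  apply: continuous_comp; last exact: sqrt_continuous.
  apply: (@continuousB _ _ _ (fun r : R => r ^+ 2) (cst (u ^+ 2))); last exact: cst_continuous.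
  exact: exprn_continuous.
have cg : {for u, continuous g}.
  apply: (@continuousM _ _ (fun s => mixed a b phi s u) (fun s => (s ^+ a * u ^+ b)^-1)); first exact: (mixed_continuous Pphi u0 u0).
  apply: continuousV; first by rewrite mulf_neq0// expf_neq0 ?gt_eqF.
  apply: continuousM; last exact: cst_continuous.
  exact: exprn_continuous.
have cgh : {for t, continuous (g \o h)}.
  by apply: continuous_comp => //; rewrite [h t]eu.
have hE r : u < r -> zeta r = g (h r).
  move=> ur; have r0 : 0 < r by rewrite (lt_trans u0).
  have rr : 0 < r ^+ 2 - u ^+ 2 by rewrite subr_gt0 ltrXn2r// ?nnegrE ?ltW.
  have h0 : 0 < h r by rewrite /h /= sqrtr_gt0.
  rewrite /g -Hz//; congr zeta; rewrite /h /= sqr_sqrtr ?ltW// subrK sqrtr_sqr.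
  by rewrite gtr0_norm.
rewrite /prop_for /continuous_at hE//.
apply: cvg_trans cgh; apply: near_eq_cvg; near=> r.
by rewrite /= hE//; near: r; exact: lt_nbhsr.
Unshelve. all: by end_near. Qed.

Definition density c zeta r := zeta r * r ^+ c.-1.

Lemma density_tailfun c : tailfun L (density c zeta).
Proof.
split=> [x x0|x Lx]; last by rewrite /density profile_eq0 ?mul0r.
by apply: continuousM; [exact: profile_continuous|exact: exprn_continuous].
Qed.

End FixedProfile.
End Profile.

(** * Tail integrals of the profile: axes, rays and sides of squares *)

Section ProfileTail.
Variable R : realType.
Notation leb := (@lebesgue_measure R).
Implicit Types (f g F zeta : R -> R) (s t x y l L M K e d : R) (n a b c : nat) (phi q : R -> R -> R).

(** The bound serves the second summand of [D_norm], the limit the last clause of [in_D]. *)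
Definition tail_controlled (Z : R -> R) K := (forall t, 0 < t -> `|Z t| <= K) /\
  exists l, forall e, 0 < e -> exists2 d, 0 < d & forall t, 0 < t <= d -> `|Z t - l| <= e.

(** At [0] only a right limit of the primitive is asked, since in [integral_shell] it is given by a
    formula for [y > 0] and patched at [0]. *)
Lemma Rintegral_FTC2 f F : (forall y, 0 <= y <= 1 -> {for y, continuous f}) ->
  (forall y, 0 < y < 1 -> is_derive y 1 F (f y)) ->
  F y @[y --> 0^'+] --> F 0 -> {for 1, continuous F} ->
  Rintegral leb `[0, 1] f = F 1 - F 0.
Proof.
move=> cf dF F0 F1; rewrite /Rintegral (@continuous_FTC2 R f F 0 1) //.
- exact: within_continuous_itv.
- split=> //.
    by move=> y; rewrite in_itv/= => /dF[].
  exact: cvg_at_left_filter.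
- by move=> y; rewrite in_itv/= => /dF[? <-]; rewrite derive1E.
Qed.

(** The radius of [(1, y)]; thus [x * lam y] is the radius of [(x, x y)]. *)
Definition lam y : R := Num.sqrt (1 + y ^+ 2).

Lemma lam_gt0 y : 0 < lam y.
Proof. by rewrite sqrtr_gt0 ltr_pwDl// sqr_ge0. Qed.

Lemma lam_ge1 y : 1 <= lam y.
Proof. by rewrite -[leLHS](sqrtr1 R) ler_sqrt ?lerDl ?sqr_ge0// addr_ge0// sqr_ge0. Qed.

Lemma lam_le2 y : 0 <= y <= 1 -> lam y <= 2.
Proof.
move=> /andP[y0 y1]; have y2 : y ^+ 2 <= 1 by rewrite exprn_ile1.
rewrite -(ger0_norm (_ : 0 <= 2 :> R))// -sqrtr_sqr ler_sqrt; lra.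
Qed.

Lemma mul_lam x y : 0 < x -> x * lam y = Num.sqrt (x ^+ 2 + (x * y) ^+ 2).
Proof.
move=> x0; rewrite (_ : x ^+ 2 + (x * y) ^+ 2 = x ^+ 2 * (1 + y ^+ 2)); last by ring.
by rewrite sqrtrM ?sqr_ge0// sqrtr_sqr gtr0_norm.
Qed.

Lemma continuous_lam y : {for y, continuous lam}.
Proof.
apply: (@continuous_comp _ _ _ (fun y : R => 1 + y ^+ 2) Num.sqrt); last exact: sqrt_continuous.
apply: (@continuousD _ _ _ (cst (1 : R)) (fun y : R => y ^+ 2)); first exact: cst_continuous.
exact: exprn_continuous.
Qed.

(* The weight of the ray [t = y s] plus that of [s = y t], after substituting [t = y s], resp.
   [s = y t], in [s ^ (a - 1) * t ^ (b - 1) ds dt] and rescaling to the radius. *)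
Definition angular a b y := (y ^+ a.-1 + y ^+ b.-1) / lam y ^+ (a + b).

Definition angular_mass a b := Rintegral leb `[0, 1] (angular a b).

Lemma continuous_angular a b y : {for y, continuous (angular a b)}.
Proof.
apply: (@continuousM _ _ (fun y : R => y ^+ a.-1 + y ^+ b.-1) (fun y => (lam y ^+ (a + b))^-1)).
  apply: (@continuousD _ _ _ (fun y : R => y ^+ a.-1) (fun y : R => y ^+ b.-1)).
    exact: exprn_continuous.
  exact: exprn_continuous.
apply: (@continuousV _ _ (fun y => lam y ^+ (a + b))).
  by rewrite expf_neq0// gt_eqF ?lam_gt0.
apply: (@continuous_comp _ _ _ lam (fun v : R => v ^+ (a + b))); first exact: continuous_lam.
exact: exprn_continuous.
Qed.

Lemma angular_ge0 a b y : 0 <= y -> 0 <= angular a b y.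
Proof.
by move=> y0; rewrite divr_ge0 ?addr_ge0 ?exprn_ge0// ltW// lam_gt0.
Qed.

(** Since [lam y <= 2] on [[0, 1]], the weight is at least [y^(b-1) / 2^(a+b)], whose integral is
    the constant [C] below. *)
Lemma angular_mass_gt0 a b : (0 < b)%N -> 0 < angular_mass a b.
Proof.
move=> b0; have bR : 0 < b%:R :> R by rewrite ltr0n.
have c0 : 0 < 2 ^+ (a + b) :> R by rewrite exprn_gt0.
pose f y : R := b%:R * y ^+ b.-1.
have cf y : {for y, continuous f}.
  by apply: continuousM; [exact: cst_continuous|exact: exprn_continuous].
have If : Rintegral leb `[0, 1] f = 1.
  transitivity (1 ^+ b - 0 ^+ b : R); last by rewrite expr1n expr0n eqn0Ngt b0 subr0.
  apply: (@Rintegral_FTC2 f (fun y => y ^+ b)).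
  - by move=> y _; exact: cf.
  - by move=> y _; exact: is_derive_expn.
  - by apply: cvg_at_right_filter; have := @exprn_continuous R b 0.
  - exact: exprn_continuous.
pose C : R := (b%:R * 2 ^+ (a + b))^-1.
have C0 : 0 < C by rewrite invr_gt0 mulr_gt0.
have iF : leb.-integrable `[0, 1] (EFin \o f).
  by apply: itv_integrable; apply: within_continuous_itv => y _; exact: cf.
apply: lt_le_trans C0 _; rewrite -[leLHS]mulr1 -If -RintegralZl//.
apply: le_Rintegral => //.
- apply: itv_integrable; apply: within_continuous_itv => y _.
  by apply: continuousM; [exact: cst_continuous|exact: cf].
- by apply: itv_integrable; apply: within_continuous_itv => y _; exact: continuous_angular.
- move=> y; rewrite /= in_itv/= => y01; have /andP[y0 y1] := y01.
  rewrite /C /f /angular invfM mulrACA mulVf ?gt_eqF// mul1r mulrC.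
  apply: ler_pM; rewrite ?exprn_ge0 ?invr_ge0 ?exprn_ge0//.
    by rewrite lerDr exprn_ge0.
  rewrite lef_pV2 ?posrE ?exprn_gt0 ?lam_gt0//.
  by rewrite lerXn2r ?nnegrE ?(ltW (lam_gt0 _))// lam_le2.
Qed.

Section FixedProfile.
Variables (L M : R) (phi : R -> R -> R) (a b : nat) (zeta : R -> R).
Hypotheses (Pphi : planefun L M phi) (L0 : 0 < L) (Hz : profile a b phi zeta).
Hypothesis ball0 : forall u v, 0 < u -> 0 < v -> L ^+ 2 <= u ^+ 2 + v ^+ 2 -> phi u v = 0.

Let czeta t (t0 : 0 < t) : {for t, continuous zeta} := profile_continuous Pphi Hz t0.
Let Tk : tailfun L (density (a + b) zeta) := density_tailfun Pphi L0 Hz ball0 (a + b).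

(* [zeta] on the axis [s = 0] is obtained by letting [s] tend to [0] in [profile]. *)
Lemma profile_edge t : a = 0%N -> 0 < t ->
  zeta t = (phi 0 t - b%:R * wtail b (phi 0) t) / t ^+ b.
Proof.
move=> a0 t0.
pose A := zeta \o (fun s => Num.sqrt (s ^+ 2 + t ^+ 2)).
pose B s := (phi s t - b%:R * wtail b (phi s) t) / t ^+ b.
have sq0 : Num.sqrt (0 ^+ 2 + t ^+ 2) = t by rewrite expr0n add0r sqrtr_sqr gtr0_norm.
have cA : {for 0, continuous A}.
  apply: continuous_comp; last by rewrite sq0; exact: czeta.
  apply: (@continuous_comp _ _ _ (fun s : R => s ^+ 2 + t ^+ 2) Num.sqrt); last exact: sqrt_continuous.
  apply: (@continuousD _ _ _ (fun s : R => s ^+ 2) (cst (t ^+ 2))); last exact: cst_continuous.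
  exact: exprn_continuous.
have cB : {for 0, continuous B}.
  apply: (@continuousM _ _ (fun s => phi s t - b%:R * wtail b (phi s) t) (cst (t ^+ b)^-1));
    last exact: cst_continuous.
  apply: (@continuousB _ _ _ (phi^~ t) (fun s => b%:R * wtail b (phi s) t)).
    exact: (planefun_cont1 Pphi).
  apply: continuousM; first exact: cst_continuous.
  exact: (wtail1_continuous (planefun_swap Pphi) t0).
have AB s : 0 < s -> A s = B s.
  by move=> s0; rewrite /A /= Hz// /mixed a0 /B expr0 mul1r !mul0r sub0r subr0 addrC.
have h1 : A s @[s --> 0^'+] --> A 0 by exact: cvg_at_right_filter.
have h2 : B s @[s --> 0^'+] --> B 0 by exact: cvg_at_right_filter.
have h3 : A s @[s --> 0^'+] --> B 0.
  apply: cvg_trans h2; apply: near_eq_cvg; near=> s.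
  by rewrite AB//; near: s; exact: nbhs_right_gt.
have := cvg_unique _ h1 h3; rewrite /A/= sq0; exact.
Unshelve. all: by end_near. Qed.

(** By [profile_edge], the Euler equation of [wtail b (phi 0)] says that its derivative is minus the
    density. *)
Lemma tail_edge t : a = 0%N -> (0 < b)%N -> 0 < t ->
  tail (density (a + b) zeta) t = wtail b (phi 0) t.
Proof.
move=> a0 b0; apply: (@tail_unique R L) => //.
- move=> x x0; have := is_derive_wtail b x0 (planefun_tailfun2 Pphi 0).
  move/is_derive_eq; apply; rewrite /density profile_edge// a0 add0n.
  have xn : x != 0 by rewrite gt_eqF.
  case: b b0 => // n _; rewrite /= exprS; field.
  by rewrite xn expf_neq0.
- by move=> x Lx; apply: wtail_eq0 => v /(le_trans Lx); exact: (planefun_eq02 Pphi).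
Qed.

Lemma tail_controlled_edge : a = 0%N -> (0 < b)%N ->
  tail_controlled (tail (density (a + b) zeta)) M.
Proof.
move=> a0 b0; have b1 : 1 <= b%:R :> R by rewrite ler1n.
split=> [t t0|].
  rewrite tail_edge//; apply: le_trans (wtail1_bound (planefun_swap Pphi) b 0 t0).
  by rewrite [leRHS]normrM normr_nat ler_peMl.
exists (phi 0 0 / b%:R) => e e0.
have [d d0 H] := wtail_planefun_cvg0 Pphi b0 e0.
exists d => // t td; have /andP[t0 _] := td.
rewrite tail_edge//; apply: le_trans (H 0 t _ td); last by rewrite lexx ltW.
have -> : b%:R * wtail b (phi 0) t - phi 0 0 = b%:R * (wtail b (phi 0) t - phi 0 0 / b%:R).
  by field; rewrite pnatr_eq0 -lt0n.
by rewrite [leRHS]normrM normr_nat ler_peMl.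
Qed.

(** On [[x, 2 x]] the density is at most [K / x], and the interval from [x] to [x y] has length at
    most [x]. *)
Lemma tail_increment K x y : (0 < a + b)%N -> 0 < x ->
  (forall r, x <= r <= 2 * x -> r ^+ (a + b) * `|zeta r| <= K) -> 1 <= y <= 2 ->
  `|tail (density (a + b) zeta) x - tail (density (a + b) zeta) (x * y)| <= K.
Proof.
move=> c0 x0 Kr /andP[y1 y2].
have K0 : 0 <= K.
  apply: le_trans (Kr x _); last by apply/andP; split; lra.
  by rewrite mulr_ge0// exprn_ge0// ltW.
have xy : x <= x * y by rewrite ler_peMr// ltW.
apply: le_trans (_ : - (K / x) * x - - (K / x) * (x * y) <= K); last first.
  rewrite (_ : _ - _ = K * (y - 1)); last by field; lra.
  by rewrite ler_piMr//; lra.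
apply: (@norm_increment_le R _ (fun v => - density (a + b) zeta v) (fun v => - (K / x) * v) (cst (K / x))) => //.
- by move=> v /andP[xv _]; exact: (is_derive_tail (lt_le_trans x0 xv) Tk).
- by move=> v _; apply: is_derive1Z (is_derive_id _ _) _; rewrite mulr1.
- move=> v /andP[xv vy]; have v0 : 0 < v := lt_le_trans x0 xv.
  have {}vy : v <= 2 * x by apply: le_trans vy _; rewrite mulrC ler_pM2r.
  have := Kr v; rewrite xv vy => /(_ isT) h.
  rewrite normrN /density normrM (gtr0_norm (exprn_gt0 _ v0)) /cst ler_pdivlMr//.
  apply: le_trans h; rewrite -{2}(prednK c0) exprS -mulrA.
  rewrite (_ : `|zeta v| * _ * x = x * (v ^+ (a + b).-1 * `|zeta v|)); last by ring.
  by rewrite ler_wpM2r// mulr_ge0// exprn_ge0// ltW.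
Qed.

(** The integrand [s^(a-1) t^(b-1) zeta] on the side [s = x] of the square, with [t = x y] and the
    Jacobian [x] included. *)
Definition shell x y := y ^+ b.-1 * x ^+ (a + b).-1 * zeta (x * lam y).

Lemma continuous_shell x y : 0 < x -> {for y, continuous (shell x)}.
Proof.
move=> x0; apply: (@continuousM _ _ (fun y => y ^+ b.-1 * x ^+ (a + b).-1) (fun y => zeta (x * lam y))).
  apply: (@continuousM _ _ (fun y : R => y ^+ b.-1) (cst (x ^+ (a + b).-1))).
    exact: exprn_continuous.
  exact: cst_continuous.
apply: (@continuous_comp _ _ _ (fun y => x * lam y) zeta).
  by apply: continuousM; [exact: cst_continuous|exact: continuous_lam].
by apply: czeta; rewrite mulr_gt0// lam_gt0.
Qed.

(* The integrand is the derivative of [slope a b phi x (x * y) / x]. *)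
Lemma integral_shell x : (0 < b)%N -> 0 < x -> Rintegral leb `[0, 1] (shell x) =
  (slope a b phi x x - (a%:R * wtail a (phi^~ 0) x - phi x 0) / b%:R) / x.
Proof.
move=> b0 x0; have bn : b%:R != 0 :> R by rewrite pnatr_eq0 -lt0n.
have xn : x != 0 by rewrite gt_eqF.
pose l := (a%:R * wtail a (phi^~ 0) x - phi x 0) / b%:R.
pose F0 y := x^-1 * slope a b phi x (x * y).
(* [l] is the limit of [slope a b phi x t] as [t] tends to [0]. *)
pose F y := if y == 0 then x^-1 * l else F0 y.
have dF0 y : 0 < y -> is_derive y 1 F0 (shell x y).
  move=> y0; have xy0 : 0 < x * y by rewrite mulr_gt0.
  have d1 : is_derive y 1 (fun y => x * y) x.
    by apply: is_derive1Z (is_derive_id _ _) _; rewrite mulr1.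
  apply: is_derive1Z (is_derive1_comp (is_derive_slope a b Pphi x0 xy0) d1) _.
  rewrite /shell mul_lam// Hz//; case: b b0 => // n _.
  rewrite addnS /= exprMn !exprS exprD; field.
  by rewrite xn !expf_neq0 ?gt_eqF.
have dF y : 0 < y -> is_derive y 1 F (shell x y).
  move=> y0; apply: near_eq_is_derive (dF0 y y0); near=> z.
  by rewrite /F gt_eqF//; near: z; exact: lt_nbhsr.
transitivity (F 1 - F 0); last by rewrite /F /F0 oner_eq0 eqxx mulr1 -/l; ring.
apply: (@Rintegral_FTC2 (shell x) F).
- by move=> y _; exact: continuous_shell.
- by move=> y /andP[y0 _]; exact: dF.
(* For [t > 0] the slope is [wtail b p t], so [b] times it tends to [p 0 = b l]. *)
- pose p v := a%:R * wtail a (phi^~ v) x - phi x v.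
  have Ta : tailfun L (fun v => a%:R * wtail a (phi^~ v) x).
    split=> [v v0|v Lv]; last by rewrite (wtail1_tailfun Pphi a x0).2 ?mulr0.
    by apply: continuousM; [exact: cst_continuous|exact: (wtail1_continuous Pphi x0)].
  have cp : {for 0, continuous p}.
    apply: (@continuousB _ _ _ (fun v => a%:R * wtail a (phi^~ v) x) (phi x)).
      by apply: continuousM; [exact: cst_continuous|exact: (wtail1_continuous Pphi x0)].
    exact: (planefun_cont2 Pphi).
  have Tp : tailfun L p.
    split=> [v v0|v Lv]; last by rewrite /p Ta.2// (planefun_eq02 Pphi)// subr0.
    by apply: continuousB; [exact: Ta.1|exact: (planefun_cont2 Pphi)].
  have pM v : `|p v| <= M + M.
    rewrite (le_trans (ler_normB _ _))// lerD ?(planefun_le Pphi)//.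
    exact: (wtail1_bound Pphi a v x0).
  have M0 : 0 <= M by apply: le_trans (planefun_le Pphi 0 0).
  have sp t : 0 < t -> slope a b phi x t = wtail b p t.
    move=> t0; rewrite (wtailB b Ta (planefun_tailfun2 Pphi x) t0).
    by rewrite (wtailZ b a%:R (wtail1_tailfun Pphi a x0) t0).
  rewrite [F 0]/F eqxx.
  have : F0 y @[y --> 0^'+] --> x^-1 * l.
    apply: (@cvgM _ _ _ _ (cst x^-1) (fun y => slope a b phi x (x * y))); first exact: cvg_cst.
    apply/cvgrPdist_le => e e0.
    have e0' : 0 < b%:R * e / 2 by rewrite divr_gt0// mulr_gt0// ltr0n.
    have e0'' : 0 < b%:R * e by rewrite mulr_gt0// ltr0n.
    move/cvgrPdist_le/(_ _ e0') : (cp) => /nbhs_ballP[d /= d0 Hd].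
    (* This is the threshold of [wtail_cvg0] for the bound [M + M] and the tolerance [b e]; halving
       [d] puts the closed range inside the open ball. *)
    have m0 : 0 < d / 2 * Num.min 1 (b%:R * e / (4 * (M + M + 1))).
      by rewrite mulr_gt0 ?lt_min ?ltr01 ?divr_gt0//; lra.
    near=> y.
    have y0 : 0 < y by near: y; exact: nbhs_right_gt.
    have xy0 : 0 < x * y by rewrite mulr_gt0.
    rewrite sp// distrC -(ler_pM2l (_ : 0 < b%:R)) ?ltr0n//.
    rewrite -{1}(normr_nat R b) -normrM.
    rewrite (_ : b%:R * (_ - _) = b%:R * wtail b p (x * y) - p 0); last by rewrite /p /l; field.
    apply: (@wtail_cvg0 R L b p (p 0) (M + M) (b%:R * e) (d / 2)) => //.
    - by rewrite divr_gt0.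
    - move=> v /andP[v0 vd]; rewrite distrC; apply: Hd.
      by rewrite /ball/= sub0r normrN gtr0_norm//; lra.
    - rewrite xy0 /= mulrC -ler_pdivlMr//; near: y.
      by apply: nbhs_right_le; rewrite divr_gt0.
  apply: cvg_trans; apply: near_eq_cvg; near=> y.
  by rewrite /F gt_eqF//; near: y; exact: nbhs_right_gt.
- by apply: is_derive1_continuous (dF 1 ltr01).
Unshelve. all: by end_near. Qed.

End FixedProfile.
End ProfileTail.

(** * The case of two positive exponents *)

Section Interior.
Variable R : realType.
Notation leb := (@lebesgue_measure R).
Implicit Types (f g F : R -> R) (s t x y K e d : R).
Variables (L M : R) (phi : R -> R -> R) (a b : nat) (zeta : R -> R).
Hypotheses (Pphi : planefun L M phi) (L0 : 0 < L) (Hz : profile a b phi zeta).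
Hypothesis ball0 : forall u v, 0 < u -> 0 < v -> L ^+ 2 <= u ^+ 2 + v ^+ 2 -> phi u v = 0.
Hypotheses (a0 : (0 < a)%N) (b0 : (0 < b)%N).

Let Tk : tailfun L (density (a + b) zeta) := density_tailfun Pphi L0 Hz ball0 (a + b).
Let Hz' : profile b a (swap phi) zeta := profile_swap Pphi Hz.
Let Pphi' := planefun_swap Pphi.
Let Z := tail (density (a + b) zeta).
Let an : a%:R != 0 :> R. Proof. by rewrite pnatr_eq0 -lt0n. Qed.
Let bn : b%:R != 0 :> R. Proof. by rewrite pnatr_eq0 -lt0n. Qed.
Let c0 : (0 < a + b)%N. Proof. by rewrite addn_gt0 a0. Qed.

(** The integral of [s^(a-1) t^(b-1) zeta] over the quadrant without the square [[0, x]^2], computed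
    ray by ray; dividing by [angular_mass] gives a weighted mean of [Z]. *)
Definition radial_average x := Rintegral leb `[0, 1] (fun y => angular a b y * Z (x * lam y)).

(* [corner x] is [H x 0 + H 0 x - H x x] for [H = wtail2 a b phi], whose values on the axes are
   limits. *)
Definition corner x :=
  wtail a (phi^~ 0) x / b%:R + wtail b (phi 0) x / a%:R - wtail2 a b phi x x.

Lemma continuous_average_integrand x y : 0 < x ->
  {for y, continuous (fun y => angular a b y * Z (x * lam y))}.
Proof.
move=> x0; apply: (@continuousM _ _ (angular a b) (fun y => Z (x * lam y))).
  exact: continuous_angular.
apply: (@continuous_comp _ _ _ (fun y => x * lam y) Z).
  by apply: continuousM; [exact: cst_continuous|exact: continuous_lam].
have xl : 0 < x * lam y by rewrite mulr_gt0// lam_gt0.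
exact: is_derive1_continuous (is_derive_tail xl Tk).
Qed.

(** Differentiating under the integral cancels all powers of [lam y] outside [zeta] and leaves the
    two sides of the square. *)
Lemma is_derive_radial_average x : 0 < x -> is_derive x 1 radial_average
  (- (Rintegral leb `[0, 1] (shell a b zeta x) + Rintegral leb `[0, 1] (shell b a zeta x))).
Proof.
move=> x0; have x20 : 0 < x / 2 by rewrite divr_gt0.
pose g z y := -1 * (shell a b zeta z y + shell b a zeta z y).
have iS : leb.-integrable `[0, 1] (EFin \o shell a b zeta x).
  by apply: itv_integrable; apply: within_continuous_itv => y _; exact: (continuous_shell Pphi Hz).
have iS' : leb.-integrable `[0, 1] (EFin \o shell b a zeta x).
  by apply: itv_integrable; apply: within_continuous_itv => y _; exact: (continuous_shell Pphi' Hz').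
have : is_derive x 1 radial_average (Rintegral leb `[0, 1] (g x)).
  (* The factor [2] bounds [y^(a-1) + y^(b-1)], the bracket is [profile_bound] used with
     [lam y >= 1], and [x / 2 < z] supplies the missing power of [z]. *)
  apply: (@is_derive_itv_integral R _ g 0 1 (x / 2) (x + 1)
    (2 * (4 * Num.sqrt 2 ^+ (a + b) * M) / (x / 2))).
  - move=> z /andP[xz _]; apply: within_continuous_itv => y _.
    by apply: continuous_average_integrand; exact: lt_trans xz.
  - move=> z y /andP[xz _] _; have z0 : 0 < z by exact: lt_trans xz.
    have l0 := lam_gt0 y; have ln : lam y != 0 by rewrite gt_eqF.
    have zl : 0 < z * lam y by rewrite mulr_gt0.
    have d1 : is_derive z 1 (fun z => z * lam y) (lam y).
      by apply: is_derive1M (is_derive_id _ _) (is_derive_cst _ _ _) _; rewrite mul1r mulr0 addr0.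
    have d2 : is_derive z 1 (fun z => Z (z * lam y)) (- density (a + b) zeta (z * lam y) * lam y).
      exact (@is_derive1_comp R Z (fun z => z * lam y) z _ _ (is_derive_tail zl Tk) d1).
    apply: (is_derive1Z (c := angular a b y) d2).
    have e : lam y ^+ (a + b) = lam y * lam y ^+ (a + b).-1 by rewrite -exprS prednK.
    rewrite /g /shell /density /angular [(b + a)%N]addnC e exprMn; field.
    by rewrite ln expf_neq0.
  - move=> z y /andP[xz _] y01; have z0 : 0 < z by exact: lt_trans xz.
    have /andP[y0 y1] := y01.
    have zl : 0 < z * lam y by rewrite mulr_gt0// lam_gt0.
    have h := profile_bound Pphi Hz zl.
    have h1 : z ^+ (a + b) * `|zeta (z * lam y)| <= 4 * Num.sqrt 2 ^+ (a + b) * M.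
      apply: le_trans h; rewrite ler_wpM2r// exprMn.
      by apply: ler_peMr; rewrite ?exprn_ge0 ?(ltW z0) ?exprn_ege1 ?lam_ge1.
    have e1 : 0 <= y ^+ a.-1 <= 1 by rewrite exprn_ge0// exprn_ile1.
    have e2 : 0 <= y ^+ b.-1 <= 1 by rewrite exprn_ge0// exprn_ile1.
    have -> : g z y = - ((y ^+ a.-1 + y ^+ b.-1) * (z ^+ (a + b).-1 * zeta (z * lam y))).
      by rewrite /g /shell [(b + a)%N]addnC; ring.
    have M0 : 0 <= M by apply: le_trans (planefun_le Pphi 0 0).
    have C0 : 0 <= 4 * Num.sqrt 2 ^+ (a + b) * M by rewrite mulr_ge0// mulr_ge0// exprn_ge0.
    rewrite normrN normrM -mulrA; apply: ler_pM => //.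
      by rewrite ger0_norm; move/andP: e1 => [? ?]; move/andP: e2 => [? ?]; lra.
    rewrite normrM (gtr0_norm (exprn_gt0 _ z0)) ler_pdivlMr//.
    apply: le_trans h1; rewrite -{2}(prednK c0) exprS -[leRHS]mulrA [leRHS]mulrC.
    by rewrite ler_wpM2l ?(ltW xz)// mulr_ge0// exprn_ge0// ltW.
  - by apply/andP; split; lra.
rewrite /g RintegralZl//; last first.
  apply: itv_integrable; apply: within_continuous_itv => y _.
  apply: (@continuousD _ _ _ (shell a b zeta x) (shell b a zeta x)).
    exact: (continuous_shell Pphi Hz).
  exact: (continuous_shell Pphi' Hz').
by rewrite RintegralD// mulN1r.
Qed.

(** By [integral_shell] the sides contribute the two slopes, which form the diagonal derivative of
    [wtail2], and axis terms, which are the derivatives of the two axis tails. *)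
Lemma is_derive_corner x : 0 < x -> is_derive x 1 corner
  (- (Rintegral leb `[0, 1] (shell a b zeta x) + Rintegral leb `[0, 1] (shell b a zeta x))).
Proof.
move=> x0.
rewrite (integral_shell Pphi Hz b0 x0) (integral_shell Pphi' Hz' a0 x0).
have D1 := is_derive_wtail a x0 (planefun_tailfun1 Pphi 0).
have D2 := is_derive_wtail b x0 (planefun_tailfun2 Pphi 0).
have D3 := is_derive_wtail2_diag a b Pphi x0.
have D1' := is_derive1M D1 (is_derive_cst (b%:R^-1 : R) x 1) erefl.
have D2' := is_derive1M D2 (is_derive_cst (a%:R^-1 : R) x 1) erefl.
apply: is_derive_eq (is_derive1B (is_derive1D D1' D2' erefl) D3 erefl) _.
rewrite /cst !mulr0 !addr0 /swap; field.
by rewrite an bn gt_eqF.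
Qed.

Lemma radial_average_corner x : 0 < x -> radial_average x = corner x.
Proof.
move=> x0; apply/eqP; rewrite -subr_eq0; apply/eqP.
pose m := Num.max x L.
have m0 : 0 < m by rewrite lt_max x0.
have Lm : L <= m by rewrite le_max lexx orbT.
transitivity (radial_average m - corner m).
  apply: (@derive0_const R (fun x => radial_average x - corner x)) => // y y0.
  exact: is_derive1B (is_derive_radial_average y0) (is_derive_corner y0) (subrr _).
have -> : radial_average m = 0.
  rewrite /radial_average (_ : Rintegral _ _ _ = Rintegral leb `[0, 1] (cst 0)).
    by rewrite /Rintegral integral0.
  apply: eq_Rintegral => y _; rewrite /Z (tail_eq0 (t := m * lam y)) ?mulr0// => r mr.
  apply: Tk.2; apply: le_trans mr; apply: le_trans Lm _.
  by rewrite ler_peMr ?lam_ge1// ltW.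
have e1 : wtail a (phi^~ 0) m = 0.
  by apply: wtail_eq0 => u mu; apply: (planefun_eq01 Pphi); exact: le_trans mu.
have e2 : wtail b (phi 0) m = 0.
  by apply: wtail_eq0 => u mu; apply: (planefun_eq02 Pphi); exact: le_trans mu.
have e3 : wtail2 a b phi m m = 0.
  apply: wtail_eq0 => v mv; apply: wtail_eq0 => u _.
  by apply: (planefun_eq02 Pphi); exact: le_trans mv.
by rewrite /corner e1 e2 e3 !mul0r addr0 !subr0.
Qed.

(** After multiplication by [a b >= 1], each of the three terms is at most [M]. *)
Lemma corner_bound x : 0 < x -> `|corner x| <= 3 * M.
Proof.
move=> x0.
have ab1 : 1 <= a%:R * b%:R :> R by rewrite -natrM ler1n muln_gt0 a0.
apply: (@le_trans _ _ `|a%:R * b%:R * corner x|).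
  by rewrite [leRHS]normrM (ger0_norm (le_trans ler01 ab1)) ler_peMl.
have h1 := wtail1_bound Pphi a 0 x0.
have h2 := wtail1_bound Pphi' b 0 x0.
have h3 := wtail2_bound Pphi a b x0 x0.
have -> : a%:R * b%:R * corner x = a%:R * wtail a (phi^~ 0) x + b%:R * wtail b (phi 0) x
    - a%:R * b%:R * wtail2 a b phi x x.
  by rewrite /corner; field; rewrite an bn.
move: h1 h2 h3; rewrite /swap !ler_norml => /andP[? ?] /andP[? ?] /andP[? ?].
by apply/andP; split; lra.
Qed.

(** [wtail2] on the diagonal is eliminated through [mixed], which tends to [0]; six differences that
    tend to [0] remain, whence [e / 6]. *)
Lemma corner_cvg0 e : 0 < e -> exists2 d, 0 < d &
  forall x, 0 < x <= d -> `|a%:R * b%:R * corner x - phi 0 0| <= e.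
Proof.
move=> e0; have e60 : 0 < e / 6 by rewrite divr_gt0.
have [d1 d10 H1] := wtail_planefun_cvg0 Pphi b0 e60.
have [d2 d20 H2] := wtail_planefun_cvg0 Pphi' a0 e60.
have [d3 d30 H3] := mixed_cvg0 Pphi c0 e60.
have [d4 d40 H4] := planefun_cvg0 Pphi e60.
exists (Num.min (Num.min d1 d2) (Num.min d3 d4)); first by rewrite !lt_min d10 d20 d30.
move=> x /andP[x0]; rewrite !le_min => /andP[/andP[x1 x2] /andP[x3 x4]].
have x0' := ltW x0.
have h1 : `|b%:R * wtail b (phi 0) x - phi 0 0| <= e / 6.
  by apply: H1; rewrite ?lexx ?x0// ltW.
have h2 : `|b%:R * wtail b (phi x) x - phi 0 0| <= e / 6 by apply: H1; rewrite ?x0' ?x0.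
have h3 : `|a%:R * wtail a (phi^~ 0) x - phi 0 0| <= e / 6.
  by apply: H2; rewrite ?lexx ?x0// ltW.
have h4 : `|a%:R * wtail a (phi^~ x) x - phi 0 0| <= e / 6 by apply: H2; rewrite ?x0' ?x0.
have h5 : `|mixed a b phi x x| <= e / 6 by apply: H3; rewrite x0.
have h6 : `|phi x x - phi 0 0| <= e / 6 by apply: H4; rewrite x0'.
have -> : a%:R * b%:R * corner x - phi 0 0 =
    (a%:R * wtail a (phi^~ 0) x - phi 0 0) + (b%:R * wtail b (phi 0) x - phi 0 0)
    - mixed a b phi x x - (b%:R * wtail b (phi x) x - phi 0 0)
    - (a%:R * wtail a (phi^~ x) x - phi 0 0) + (phi x x - phi 0 0).
  by rewrite /corner /mixed; field; rewrite an bn.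
move: h1 h2 h3 h4 h5 h6; rewrite !ler_norml.
move=> /andP[? ?] /andP[? ?] /andP[? ?] /andP[? ?] /andP[? ?] /andP[? ?].
by apply/andP; split; lra.
Qed.

(** The quotient is a weighted mean of the [Z (x * lam y)] with [1 <= lam y <= 2], each within [K]
    of [Z x]. Since [K] is local to [[x, 2 x]], this gives boundedness as well as convergence. *)
Lemma tail_near_corner K x : 0 < x ->
  (forall r, x <= r <= 2 * x -> r ^+ (a + b) * `|zeta r| <= K) ->
  `|Z x - corner x / angular_mass R a b| <= K.
Proof.
move=> x0 Kr; have B0 := angular_mass_gt0 R a b0.
have iA : leb.-integrable `[0, 1] (EFin \o angular a b).
  by apply: itv_integrable; apply: within_continuous_itv => y _; exact: continuous_angular.
have iZ : leb.-integrable `[0, 1] (EFin \o (fun y => angular a b y * Z (x * lam y))).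
  by apply: itv_integrable; apply: within_continuous_itv => y _; exact: continuous_average_integrand.
have cZ K' y : {for y, continuous (fun y => angular a b y * K')}.
  by apply: continuousM; [exact: continuous_angular|exact: cst_continuous].
have iK K' : leb.-integrable `[0, 1] (EFin \o (fun y => angular a b y * K')).
  by apply: itv_integrable; apply: within_continuous_itv => y _; exact: cZ.
have cD y : {for y, continuous (fun y => angular a b y * Z x - angular a b y * Z (x * lam y))}.
  apply: (@continuousB _ _ _ (fun y => angular a b y * Z x)); first exact: cZ.
  exact: continuous_average_integrand.
have iD : leb.-integrable `[0, 1]
    (EFin \o (fun y => angular a b y * Z x - angular a b y * Z (x * lam y))).
  by apply: itv_integrable; apply: within_continuous_itv => y _; exact: cD.
have iN : leb.-integrable `[0, 1]
    (EFin \o (fun y => `|angular a b y * Z x - angular a b y * Z (x * lam y)|)).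
  apply: itv_integrable; apply: within_continuous_itv => y _.
  by apply: continuous_comp; [exact: cD|exact: norm_continuous].
rewrite -(ler_pM2l B0) -{1}(gtr0_norm B0) -normrM -radial_average_corner//.
have -> : angular_mass R a b * (Z x - radial_average x / angular_mass R a b) =
    Rintegral leb `[0, 1] (fun y => angular a b y * Z x - angular a b y * Z (x * lam y)).
  rewrite RintegralB// RintegralZr// -/(angular_mass R a b) -/(radial_average x).
  by field; rewrite gt_eqF.
apply: le_trans (le_normr_Rintegral _ iD) _ => //.
rewrite /angular_mass -RintegralZr//.
apply: le_Rintegral => // y; rewrite /= in_itv/= => y01; have /andP[y0 _] := y01.
rewrite -mulrBr normrM (ger0_norm (angular_ge0 a b y0)) ler_wpM2l ?angular_ge0//.
apply: (tail_increment Pphi L0 Hz ball0 c0 x0 Kr).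
by rewrite lam_ge1 lam_le2.
Qed.

Lemma tail_controlled_interior : tail_controlled Z
  ((3 / angular_mass R a b + 4 * Num.sqrt 2 ^+ (a + b)) * M).
Proof.
have B0 := angular_mass_gt0 R a b0.
have ab0 : 0 < a%:R * b%:R :> R by rewrite mulr_gt0// ltr0n.
split=> [t t0|].
  have h : `|Z t - corner t / angular_mass R a b| <= 4 * Num.sqrt 2 ^+ (a + b) * M.
    apply: tail_near_corner => // r /andP[tr _].
    exact: (profile_bound Pphi Hz (lt_le_trans t0 tr)).
  rewrite -(subrK (corner t / angular_mass R a b) (Z t)).
  apply: le_trans (ler_normD _ _) _; rewrite [leRHS]mulrDl [leLHS]addrC lerD//.
  rewrite normrM normfV (gtr0_norm B0) mulrAC ler_pM2r ?invr_gt0//.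
  exact: corner_bound.
exists (phi 0 0 / (a%:R * b%:R) / angular_mass R a b) => e e0.
have e20 : 0 < e / 2 by rewrite divr_gt0.
have e30 : 0 < e / 2 * (a%:R * b%:R * angular_mass R a b) by rewrite !mulr_gt0// ltr0n.
have [d1 d10 H1] := profile_cvg0 Pphi Hz c0 e20.
have [d2 d20 H2] := corner_cvg0 e30.
(* [tail_near_corner] looks at radii up to [2 t], hence [d1 / 2]. *)
exists (Num.min (d1 / 2) d2); first by rewrite lt_min divr_gt0.
move=> t /andP[t0]; rewrite le_min => /andP[t1 t2].
have h1 : `|Z t - corner t / angular_mass R a b| <= e / 2.
  apply: tail_near_corner => // r /andP[tr rt]; apply: H1.
  by rewrite (lt_le_trans t0 tr) /=; lra.
have h2 : `|corner t / angular_mass R a b - phi 0 0 / (a%:R * b%:R) / angular_mass R a b| <= e / 2.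
  have abB0 : 0 < a%:R * b%:R * angular_mass R a b by rewrite mulr_gt0.
  rewrite -(ler_pM2r abB0) -[X in _ * X <= _](gtr0_norm abB0) -normrM.
  have -> : (corner t / angular_mass R a b - phi 0 0 / (a%:R * b%:R) / angular_mass R a b)
      * (a%:R * b%:R * angular_mass R a b) = a%:R * b%:R * corner t - phi 0 0.
    by field; rewrite an bn gt_eqF.
  by apply: H2; rewrite t0.
apply: le_trans (ler_distD (corner t / angular_mass R a b) _ _) _; lra.
Qed.

End Interior.

(** * Functions on the quadrant *)

Section Quadrant.
Variable R : realType.
Notation leb := (@lebesgue_measure R).
Implicit Types (s t x y l L M K e d : R) (a b : nat) (phi psi : R * R -> R).

(** [C] is chosen before [L], [M], [phi] and [zeta], as the Lipschitz estimate requires. The case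
    [b = 0] is reduced to [a = 0] by exchanging the variables. *)
Lemma tail_controlled_ex a b : (0 < a + b)%N -> exists2 C : R, 0 <= C &
  forall L M (phi : R -> R -> R) zeta, planefun L M phi -> 0 < L -> profile a b phi zeta ->
  (forall u v, 0 < u -> 0 < v -> L ^+ 2 <= u ^+ 2 + v ^+ 2 -> phi u v = 0) ->
  tail_controlled (tail (density (a + b) zeta)) (C * M).
Proof.
move=> ab0; case: (posnP a) => [a0|a0].
  exists 1 => // L M phi zeta Pphi L0 Hz ball0; rewrite mul1r.
  apply: (tail_controlled_edge Pphi L0 Hz ball0 a0).
  by move: ab0; rewrite a0.
case: (posnP b) => [b0|b0].
  exists 1 => // L M phi zeta Pphi L0 Hz ball0; rewrite mul1r addnC.
  apply: (tail_controlled_edge (planefun_swap Pphi) L0 (profile_swap Pphi Hz) _ b0 a0).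
  by move=> u v u0 v0; rewrite addrC; exact: ball0.
exists (3 / angular_mass R a b + 4 * Num.sqrt 2 ^+ (a + b)) => [|L M phi zeta Pphi L0 Hz ball0].
  apply: addr_ge0; first by rewrite divr_ge0// ltW// angular_mass_gt0.
  by apply: mulr_ge0 => //; apply: exprn_ge0; exact: sqrtr_ge0.
exact: (tail_controlled_interior Pphi L0 Hz ball0 a0 b0).
Qed.

(** The support condition is made pointwise so that it passes to differences at once. *)
Definition cornered L phi := {within @quadrant R, continuous phi} /\
  forall x : R * R, quadrant x -> L ^+ 2 <= x.1 ^+ 2 + x.2 ^+ 2 -> phi x = 0.

Lemma in_Cc_ball_cornered L phi : in_Cc_ball L phi -> cornered L phi.
Proof.
case=> cphi sub; split=> // x qx Lx; apply/eqP; rewrite -[_ == _]negbK; apply/negP => nz.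
have /sub : closure [set x : R * R | quadrant x /\ phi x != 0] x by apply: subset_closure.
by rewrite /= ltNge Lx.
Qed.

Lemma corneredB L phi psi : cornered L phi -> cornered L psi ->
  cornered L (fun x : R * R => phi x - psi x).
Proof.
move=> [c1 z1] [c2 z2]; split; last by move=> x qx Lx; rewrite z1// z2// subr0.
by move=> x; apply: continuousB; [exact: c1|exact: c2].
Qed.

(** Even extension from the quadrant to the plane; it turns continuity within the quadrant into
    continuity everywhere. *)
Definition fold phi : R -> R -> R := fun u v => phi (`|u|, `|v|).

Lemma quadrant_norm (x : R * R) : quadrant (`|x.1|, `|x.2|).
Proof. by rewrite /quadrant /=. Qed.

Lemma cornered_continuous L phi : cornered L phi ->
  continuous (fun x : R * R => phi (`|x.1|, `|x.2|)).
Proof.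
move=> [/subspace_continuousP c _] x.
apply: (@cvg_comp _ _ _ (fun x : R * R => (`|x.1|, `|x.2|)) phi _ _ _ _ (c _ (quadrant_norm x))).
have h : (`|z.1|, `|z.2|) @[z --> x] --> (`|x.1|, `|x.2|).
  have f1 : fst z @[z --> x] --> x.1 by exact: cvg_fst.
  have f2 : snd z @[z --> x] --> x.2 by exact: cvg_snd.
  have g1 : `|z.1| @[z --> x] --> `|x.1| by exact: cvg_norm.
  have g2 : `|z.2| @[z --> x] --> `|x.2| by exact: cvg_norm.
  exact: (cvg_pair g1 g2).
move=> A; rewrite /within/= => /h; rewrite /nbhs/=.
by apply: filterS => z; apply; exact: quadrant_norm.
Qed.

(** A supremum is an upper bound only for a bounded set; boundedness comes from the maximum on
    [[0, L]^2], outside of which [phi] vanishes. *)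
Lemma cornered_le L phi (x : R * R) : 0 < L -> cornered L phi -> quadrant x -> `|phi x| <= max_norm phi.
Proof.
move=> L0 [c z] qx.
pose K := `[0, L]%classic `*` `[0, L]%classic : set (R * R).
have cK : compact K by apply: compact_setX; exact: segment_compact.
have K0 : K !=set0 by exists (0, 0); rewrite /K /= !in_itv /= lexx ltW.
have KQ : K `<=` @quadrant R.
  by move=> u; rewrite /K /= !in_itv/= => -[/andP[? _] /andP[? _]].
have cn : {within K, continuous (fun x : R * R => `|phi x|)}.
  have cK' := continuous_subspaceW KQ c.
  by move=> u; apply: continuous_comp; [exact: cK'|exact: norm_continuous].
have [m mK Hm] := compact_EVT_max K0 cK cn.
apply: ub_le_sup; last by exists x.
exists `|phi m| => _ [u qu <-].
have [uK|uK] := pselect (K u); first by apply: Hm; rewrite inE.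
rewrite z// ?normr0//; move: qu => [u1 u2].
have sq2 : L ^+ 2 <= u.1 ^+ 2 \/ L ^+ 2 <= u.2 ^+ 2.
  have [l1|l1] := leP L u.1; first by left; rewrite lerXn2r// nnegrE ltW.
  have [l2|l2] := leP L u.2; first by right; rewrite lerXn2r// nnegrE ltW.
  by exfalso; apply: uK; rewrite /K /= !in_itv/= u1 u2 !ltW.
by case: sq2 => h; apply: le_trans h _; rewrite ?lerDl ?lerDr sqr_ge0.
Qed.

Lemma cornered_planefun L phi : 0 < L -> cornered L phi ->
  planefun L (max_norm phi) (fold phi).
Proof.
move=> L0 Cphi; have cc := cornered_continuous Cphi; split.
- move=> v u.
  have i1 : z @[z --> u] --> u by exact: cvg_id.
  have i2 : v @[z --> u] --> v by exact: cvg_cst.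
  exact: (cvg_comp _ _ (cvg_pair i1 i2) (cc (u, v))).
- move=> u v.
  have i1 : u @[z --> v] --> u by exact: cvg_cst.
  have i2 : z @[z --> v] --> v by exact: cvg_id.
  exact: (cvg_comp _ _ (cvg_pair i1 i2) (cc (u, v))).
- move=> u v Lu; apply: Cphi.2; first exact: (quadrant_norm (u, v)).
  rewrite /= ler_wpDr ?sqr_ge0// real_normK ?num_real// lerXn2r// nnegrE ?ltW//.
  exact: lt_le_trans Lu.
- move=> u v Lv; apply: Cphi.2; first exact: (quadrant_norm (u, v)).
  rewrite /= ler_wpDl ?sqr_ge0// real_normK ?num_real// lerXn2r// nnegrE ?ltW//.
  exact: lt_le_trans Lv.
- by move=> u v; apply: (cornered_le L0 Cphi); exact: (quadrant_norm (u, v)).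
- move=> e e0.
  have /cvgrPdist_le/(_ e e0) := cc (0, 0).
  move=> /nbhs_ballP[d /= d0 Hd].
  exists (d / 2); first by rewrite divr_gt0.
  move=> u v /andP[u0 ud] /andP[v0 vd]; rewrite distrC.
  apply: (Hd (u, v)); split; rewrite /ball/= sub0r normrN ger0_norm//; lra.
Qed.

Lemma fold_ball0 L phi : cornered L phi ->
  forall u v, 0 < u -> 0 < v -> L ^+ 2 <= u ^+ 2 + v ^+ 2 -> fold phi u v = 0.
Proof.
move=> Cphi u v u0 v0 Luv; rewrite /fold; apply: Cphi.2; first exact: (quadrant_norm (u, v)).
by rewrite /= !real_normK ?num_real.
Qed.

Lemma exprz_predE n x : x != 0 -> x ^ (n%:Z - 1) = x ^+ n / x.
Proof. by move=> x0; rewrite expfzDr// exprnP exprN1. Qed.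

Lemma tailZr L f c t : tailfun L f -> 0 < t -> tail (fun v => f v * c) t = tail f t * c :> R.
Proof. by move=> Tf t0; apply: RintegralZr => //; exact: tail_integrable t0 Tf. Qed.

(** Derivatives at positive points only see positive arguments, where [phi] and [fold phi] agree and
    the double integral is [wtail2]. *)
Lemma StildeE L phi a b s t : 0 < L -> cornered L phi -> 0 < s -> 0 < t ->
  Stilde a b phi s t = mixed a b (fold phi) s t / (s ^+ a * t ^+ b).
Proof.
move=> L0 Cphi s0 t0; have P := cornered_planefun L0 Cphi.
pose H s t := s ^+ a * t ^+ b * tail (fun v => tail (fun u => phi (u, v) / (u ^+ a.+1 * v ^+ b.+1)) s) t.
have HE s' t' : 0 < s' -> 0 < t' -> H s' t' = wtail2 a b (fold phi) s' t'.
  move=> s'0 t'0; have sn : s' ^+ a != 0 by rewrite expf_neq0 ?gt_eqF.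
  rewrite /H (@eq_tail R _ (fun v => wtail a ((fold phi)^~ v) s' / v ^+ b.+1 * (s' ^+ a)^-1)).
    rewrite (tailZr _ (tailfun_weight b.+1 (wtail1_tailfun P a s'0)) t'0) /wtail2 [RHS]/wtail.
    by field.
  move=> v tv; have v0 : 0 < v := lt_le_trans t'0 tv.
  have vn : v ^+ b.+1 != 0 by rewrite expf_neq0 ?gt_eqF.
  rewrite (@eq_tail R _ (fun u => fold phi u v / u ^+ a.+1 * (v ^+ b.+1)^-1)).
    rewrite (tailZr _ (tailfun_weight a.+1 (planefun_tailfun1 P v)) s'0) /wtail; field.
    by rewrite sn vn.
  move=> u su; have u0 : 0 < u := lt_le_trans s'0 su.
  by rewrite /fold (gtr0_norm u0) (gtr0_norm v0) invfM mulrA.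
have e : Stilde a b phi s t = (s ^ (a%:Z - 1) * t ^ (b%:Z - 1))^-1 *
  derive1 (fun s' => derive1 (fun t' => H s' t') t) s by [].
have d1 s' : 0 < s' -> (H s')^`() t = slope b a (swap (fold phi)) t s' / t.
  move=> s'0; rewrite derive1E.
  have D : is_derive t 1 (H s') (slope b a (swap (fold phi)) t s' / t).
    rewrite /slope -(wtail2_swap a b P s'0 t0).
    apply: near_eq_is_derive (is_derive_wtail2r P a b s'0 t0).
    near=> t'; rewrite HE//; near: t'; exact: lt_nbhsr.
  by case: D.
have D : is_derive s 1 (fun s' => derive1 (H s') t) (mixed a b (fold phi) s t / s / t).
  (* The inner derivative is in [t], so the outer one is the derivative of the slope of the swapped
     function. *)
  rewrite (mixed_swap a b P s0 t0).
  have D' : is_derive s 1 (fun s' => slope b a (swap (fold phi)) t s' / t)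
      (mixed b a (swap (fold phi)) t s / s / t).
    apply: is_derive1M (is_derive_slope b a (planefun_swap P) t0 s0) (is_derive_cst (t^-1 : R) s 1) _.
    by rewrite mulr0 addr0.
  apply: near_eq_is_derive D'; near=> s'; rewrite d1//; near: s'; exact: lt_nbhsr.
rewrite e derive1E; case: D => _ ->.
rewrite !exprz_predE ?gt_eqF//; field.
by rewrite !expf_neq0 ?gt_eqF.
Unshelve. all: by end_near.
Qed.

End Quadrant.

(** * Membership in the target space and the Lipschitz estimate *)

Section Continuity.
Variable R : realType.
Implicit Types (s t x y l L M K e d : R) (a b : nat) (phi psi : R * R -> R) (f g zeta xi : R -> R).

Lemma tailD_density c zeta t : (0 < c)%N -> tailD c zeta t = tail (density c zeta) t.
Proof.
move=> c0; apply: eq_tail => r _; rewrite /density; congr (_ * _).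
by rewrite -{1}(prednK c0) -addn1 PoszD addrK.
Qed.

Lemma mixedB L M M' (f g : R -> R -> R) a b s t : planefun L M f -> planefun L M' g ->
  0 < s -> 0 < t ->
  mixed a b (fun u v => f u v - g u v) s t = mixed a b f s t - mixed a b g s t.
Proof.
move=> Pf Pg s0 t0; rewrite /mixed.
have -> : wtail2 a b (fun u v => f u v - g u v) s t = wtail2 a b f s t - wtail2 a b g s t.
  rewrite /wtail2 -(wtailB b (wtail1_tailfun Pf a s0) (wtail1_tailfun Pg a s0) t0).
  apply: eq_wtail => v _.
  exact: (wtailB a (planefun_tailfun1 Pf v) (planefun_tailfun1 Pg v) s0).
rewrite (wtailB b (planefun_tailfun2 Pf s) (planefun_tailfun2 Pg s) t0).
rewrite (wtailB a (planefun_tailfun1 Pf t) (planefun_tailfun1 Pg t) s0).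
move: (wtail2 _ _ f _ _) (wtail2 _ _ g _ _) (wtail b (f s) t) (wtail b (g s) t)
  (wtail a (f^~ t) s) (wtail a (g^~ t) s) => h1 h2 h3 h4 h5 h6.
by ring.
Qed.

(** The point [(s, t)] and the diagonal point of the same radius have equal [s^2 + t^2], so
    radiality identifies the two values. *)
Lemma Sab_profile L phi a b : 0 < L -> in_Cab a b L phi -> profile a b (fold phi) (Sab a b phi).
Proof.
move=> L0 [/in_Cc_ball_cornered Cphi rad] s t s0 t0.
rewrite -(StildeE _ _ L0 Cphi s0 t0) /Sab; apply: rad => //.
- by rewrite divr_gt0 ?sqrtr_gt0// ltr_pwDl ?exprn_gt0 ?sqr_ge0.
- by rewrite divr_gt0 ?sqrtr_gt0// ltr_pwDl ?exprn_gt0 ?sqr_ge0.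
- have st : 0 <= s ^+ 2 + t ^+ 2 by rewrite addr_ge0 ?sqr_ge0.
  by rewrite expr_div_n !sqr_sqrtr//; lra.
Qed.

Lemma max_norm_ge0 L phi : 0 < L -> cornered L phi -> 0 <= max_norm phi.
Proof.
move=> L0 Cphi; apply: le_trans (normr_ge0 (phi (0, 0))) _.
by apply: (cornered_le L0 Cphi); split; rewrite /= lexx.
Qed.

Lemma D_norm_le c zeta K1 K2 :
  (forall t, 0 < t -> t ^+ c * `|zeta t| <= K1) ->
  (forall t, 0 < t -> `|tailD c zeta t| <= K2) -> D_norm c zeta <= K1 + K2.
Proof.
move=> H1 H2; apply: lerD; apply: ge_sup.
- by exists (1 ^+ c * `|zeta 1|); exists 1 => //=; exact: ltr01.
- by move=> _ [t /= t0 <-]; exact: H1.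
- by exists `|tailD c zeta 1|; exists 1 => //=; exact: ltr01.
- by move=> _ [t /= t0 <-]; exact: H2.
Qed.

Lemma Sab_in_D L phi a b : (0 < a + b)%N -> 0 < L -> in_Cab a b L phi ->
  in_D (a + b) L (Sab a b phi).
Proof.
move=> ab0 L0 Cphi; have Cc := in_Cc_ball_cornered Cphi.1.
have P := cornered_planefun L0 Cc; have Hz := Sab_profile L0 Cphi.
have B0 := fold_ball0 Cc.
split; first by move=> t t0; exact: (profile_continuous P Hz t0).
split; first by move=> t /ltW Lt; exact: (profile_eq0 L0 Hz B0 Lt).
split.
  apply/cvgr0Pnorm_le => e e0.
  have [d d0 H] := profile_cvg0 P Hz ab0 e0.
  near=> t; have t0 : 0 < t by near: t; exact: nbhs_right_gt.
  rewrite normrM (gtr0_norm (exprn_gt0 _ t0)); apply: H; rewrite t0 /=.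
  by near: t; exact: nbhs_right_le.
have [C _ HC] := tail_controlled_ex R ab0.
have [_ [l Hl]] := HC _ _ _ _ P L0 Hz B0.
apply/cvg_ex; exists l; apply/cvgrPdist_le => e e0.
have [d d0 H] := Hl _ e0.
near=> t; have t0 : 0 < t by near: t; exact: nbhs_right_gt.
rewrite tailD_density// distrC; apply: H; rewrite t0 /=.
by near: t; exact: nbhs_right_le.
Unshelve. all: by end_near. Qed.

(** By linearity of [mixed], the difference of the transforms is a profile of [phi - psi], to which
    the uniform bounds apply directly. *)
Lemma Sab_lipschitz a b : (0 < a + b)%N -> exists2 C : R, 0 <= C &
  forall L phi psi, 0 < L -> in_Cab a b L phi -> in_Cab a b L psi ->
  D_norm (a + b) (fun t => Sab a b phi t - Sab a b psi t) <=
    C * max_norm (fun x : R * R => phi x - psi x).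
Proof.
move=> ab0; have [C C0 HC] := tail_controlled_ex R ab0.
exists (4 * Num.sqrt 2 ^+ (a + b) + C) => [|L phi psi L0 Cphi Cpsi].
  by rewrite addr_ge0// mulr_ge0// exprn_ge0// sqrtr_ge0.
have Cc1 := in_Cc_ball_cornered Cphi.1; have Cc2 := in_Cc_ball_cornered Cpsi.1.
have Cc := corneredB Cc1 Cc2; have P := cornered_planefun L0 Cc.
have Hz : profile a b (fold (fun x : R * R => phi x - psi x)) (fun t => Sab a b phi t - Sab a b psi t).
  move=> s t s0 t0; rewrite (Sab_profile L0 Cphi s0 t0) (Sab_profile L0 Cpsi s0 t0) -mulrBl.
  congr (_ / _); apply/esym.
  exact: mixedB (cornered_planefun L0 Cc1) (cornered_planefun L0 Cc2) s0 t0.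
rewrite mulrDl; apply: D_norm_le => t t0; first exact: (profile_bound P Hz t0).
rewrite tailD_density//.
exact: (HC _ _ _ _ P L0 Hz (fold_ball0 Cc)).1.
Qed.

End Continuity.

Theorem theorem3p10 (R : realType) (a b : nat) (Rad : R) :
  (1 <= a + b)%N -> 0 < Rad ->
  (forall phi : R * R -> R, in_Cab a b Rad phi -> in_D (a + b) Rad (Sab a b phi)) /\
  (forall phi : R * R -> R, in_Cab a b Rad phi ->
     forall eps : R, 0 < eps -> exists2 delta : R, 0 < delta &
       forall psi : R * R -> R, in_Cab a b Rad psi ->
         max_norm (fun x => phi x - psi x) < delta ->
         D_norm (a + b) (fun t => Sab a b phi t - Sab a b psi t) < eps).
Proof.
move=> ab0 Rad0; split=> [phi|phi Cphi eps eps0]; first exact: Sab_in_D.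
have [C C0 HC] := @Sab_lipschitz R a b ab0.
have C1 : 0 < C + 1 by rewrite ltr_wpDl.
(* [C + 1] is positive even when the Lipschitz constant is [0]. *)
exists (eps / (C + 1)) => [|psi Cpsi]; first by rewrite divr_gt0.
rewrite ltr_pdivlMr// mulrC => lt.
apply: le_lt_trans (HC _ _ _ Rad0 Cphi Cpsi) _; apply: le_lt_trans lt.
apply: ler_wpM2r; last by rewrite lerDl.
exact: (max_norm_ge0 Rad0 (corneredB (in_Cc_ball_cornered Cphi.1) (in_Cc_ball_cornered Cpsi.1))).
Qed.
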